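(* Let $z$ be a random real that computes a proper pruned tree $T$ and an order $g$ such that $\log|T\cap 2^n|\geq g(n)+\mathsf{d}(T\cap 2^n)$ for all $n$, and suppose that the sequence $(|T\cap 2^n|)_{n}$ is computable. Then $z\geq_T\emptyset'$.
   Context: $2^{<\omega}$ is the set of finite binary strings, $2^n$ the set of $n$-bit strings; reals are infinite binary sequences. $K$ is prefix-free Kolmogorov complexity; $\log$ is base 2. ''Random'' means Martin-Löf random; $\leq_T$ is Turing reducibility; $\emptyset'$ is the halting problem. An order is a nondecreasing unbounded function $\mathbb{N}\to\mathbb{N}$. A tree is a nonempty set $T\subseteq 2^{<\omega}$ that is downward-closed under the prefix relation $\preceq$. $T$ is pruned if it has no $\preceq$-maximal element, and proper if $n\mapsto|T\cap 2^n|$ is unbounded. For a set $E$ of strings, $\mathsf{d}(E)=\sup_{\sigma\in E}(|\sigma|-K(\sigma))$. ''$z$ computes'' an object means the object is Turing reducible to $z$. *)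

(* Defs.v *)
From Stdlib Require Cantor.
From mathcomp Require Import all_boot all_order all_algebra.
From mathcomp Require Import all_classical all_reals.
From mathcomp Require Import ereal exp.

Set Implicit Arguments.
Unset Strict Implicit.
Unset Printing Implicit Defensive.

Import Order.TTheory GRing.Theory Num.Theory.

(* Oracle computability: the functions partial recursive in an oracle          *)
(* o : nat -> nat, presented by programs with one natural number as input.     *)
(* Several arguments are packed with the bijection Cantor.to_nat.              *)

Inductive prog : Type :=
  | PZero
  | PSucc
  | PFst
  | PSnd
  | POracle
  | PPair of prog & prog
  | PComp of prog & prog
  | PRec of prog & prog
  | PMin of prog.

Definition npair (x y : nat) : nat := Cantor.to_nat (x, y).
Definition nfst (n : nat) : nat := (Cantor.of_nat n).1.
Definition nsnd (n : nat) : nat := (Cantor.of_nat n).2.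

(* prim_rec F G a n y : y is the value at n of the partial function h with     *)
(* h 0 = F a and h (n + 1) = G <a, <n, h n>>.                                  *)
Fixpoint prim_rec (F G : nat -> nat -> Prop) (a n y : nat) : Prop :=
  match n with
  | 0 => F a y
  | m.+1 => exists2 r, prim_rec F G a m r & G (npair a (npair m r)) y
  end.

(* run o c x y : the program c halts with output y on input x and oracle o.    *)
Fixpoint run (o : nat -> nat) (c : prog) (x y : nat) : Prop :=
  match c with
  | PZero => y = 0
  | PSucc => y = x.+1
  | PFst => y = nfst x
  | PSnd => y = nsnd x
  | POracle => y = o x
  | PPair c1 c2 => exists y1 y2, [/\ run o c1 x y1, run o c2 x y2 & y = npair y1 y2]
  | PComp c1 c2 => exists2 u, run o c2 x u & run o c1 u y
  | PRec c1 c2 => prim_rec (run o c1) (run o c2) (nfst x) (nsnd x) y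
  | PMin c1 => run o c1 (npair x y) 0
               /\ forall m, m < y -> exists k, run o c1 (npair x m) k.+1
  end.

(* The oracle-free case: run with the constantly zero oracle, i.e. with the    *)
(* characteristic function of the empty set.                                   *)
Definition no_oracle : nat -> nat := fun=> 0.

Definition turing_le (f o : nat -> nat) : Prop :=
  exists c, forall n, run o c n (f n).

Definition computable (f : nat -> nat) : Prop := turing_le f no_oracle.

Definition real : Type := nat -> bool.

Definition chi (x : real) : nat -> nat := fun n => nat_of_bool (x n).

(* Goedel numbering of programs; the four compound forms are separated by the  *)
(* residue mod 4.                                                              *)
Fixpoint prog_code (c : prog) : nat :=
  match c with
  | PZero => 0
  | PSucc => 1
  | PFst => 2
  | PSnd => 3
  | POracle => 4
  | PPair c1 c2 => 5 + 4 * npair (prog_code c1) (prog_code c2)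
  | PComp c1 c2 => 6 + 4 * npair (prog_code c1) (prog_code c2)
  | PRec c1 c2 => 7 + 4 * npair (prog_code c1) (prog_code c2)
  | PMin c1 => 8 + 4 * prog_code c1
  end.

Definition halting : real := fun e =>
  `[< exists c, prog_code c = e /\ exists y, run no_oracle c e y >].

(* Bijective base-2 numeration: a bijection from binary strings onto nat, with *)
(* the least significant digit first.                                          *)
Fixpoint str_code (s : bitseq) : nat :=
  if s is b :: s' then (str_code s').*2 + b + 1 else 0.

Definition computes_strings (z : real) (T : {pred bitseq}) : Prop :=
  exists c, forall s, run (chi z) c (str_code s) (nat_of_bool (s \in T)).

(* A program read as the partial computable function on binary strings that    *)
(* it defines on codes.                                                        *)
Definition machine (c : prog) (p s : bitseq) : Prop :=
  run no_oracle c (str_code p) (str_code s).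

Definition prefix_free_machine (c : prog) : Prop :=
  forall p q s t, machine c p s -> machine c q t -> prefix p q -> p = q.

Section Complexity.
Variable R : realType.
Local Open Scope classical_set_scope.
Local Open Scope ring_scope.
Local Open Scope ereal_scope.

(* Length of a shortest c-program for s, +oo if there is none.                 *)
Definition complexity (c : prog) (s : bitseq) : \bar R :=
  ereal_inf [set (size p)%:R%:E | p in [set p | machine c p s]].

Definition optimal_machine (U : prog) : Prop :=
  prefix_free_machine U /\
  forall M, prefix_free_machine M ->
    exists k : nat, forall s, complexity U s <= complexity M s + k%:R%:E.

Definition deficiency (U : prog) (E : set bitseq) : \bar R :=
  ereal_sup [set (size s)%:R%:E - complexity U s | s in E].

Definition log2 (x : R) : R := (ln x / ln 2)%R.

(* Uniform measure on Cantor space of the open set of all reals that have a    *)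
(* prefix in V: the supremum over n of the measures of the clopen sets         *)
(* generated by the strings of V of length at most n.                          *)
Definition open_measure (V : set bitseq) : \bar R :=
  ereal_sup [set (#|[set t : n.-tuple bool |
                      `[< exists2 s, V s & prefix s t >] ]%SET|%:R / 2 ^+ n)%:E
            | n in [set: nat]].

End Complexity.

Definition prefix_of_real (s : bitseq) (x : real) : Prop := s = mkseq x (size s).

Definition uniformly_ce (V : nat -> set bitseq) : Prop :=
  exists c, forall n s,
    V n s <-> exists y, run no_oracle c (npair n (str_code s)) y.

Definition ml_test (R : realType) (V : nat -> set bitseq) : Prop :=
  uniformly_ce V /\
  forall n, (open_measure R (V n) <= ((2 ^- n)%R : R)%:E)%E.

Definition ml_random (R : realType) (x : real) : Prop :=
  forall V, ml_test R V -> ~ forall n, exists2 s, V n s & prefix_of_real s x.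

Definition is_tree (T : {pred bitseq}) : Prop :=
  (exists s, s \in T) /\ forall s t, t \in T -> prefix s t -> s \in T.

Definition pruned (T : {pred bitseq}) : Prop :=
  ~ exists2 s, s \in T & forall t, t \in T -> prefix s t -> t = s.

Definition width (T : {pred bitseq}) (n : nat) : nat :=
  #|[set t : n.-tuple bool | tval t \in T]%SET|.

Definition level (T : {pred bitseq}) (n : nat) : set bitseq :=
  [set s | s \in T /\ size s = n]%classic.

Definition unbounded (f : nat -> nat) : Prop := forall b, exists n, b < f n.

Definition proper_tree (T : {pred bitseq}) : Prop := unbounded (width T).

Definition order_function (g : nat -> nat) : Prop :=
  {homo g : m n / m <= n} /\ unbounded g.

(* Main.v *)
(* For each n, close a batch of oracles X whenever the measure of those seen   *)
(* to satisfy g^X > t(n), for a computable t, passes a new multiple of 2^-n.   *)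
(* A batch closed at stage m contains only X with g^X(m) >= t(n). As the width *)
(* w of T at level m is computable, a list of about 2^m / w strings of length  *)
(* m meets level m of T^X for most X in the batch; describing a member of the  *)
(* list by its position costs about m - log w bits, which is impossible for    *)
(* members of T once t(n) exceeds the overhead. So z is not among the oracles  *)
(* that are hit. Hence, if z lies in batches for infinitely many n, it lies in *)
(* infinitely many open sets U_k without ever entering V_k, where U_k \ V_k    *)
(* has measure at most 2^-k; if z lies in batches for only finitely many n,    *)
(* the same holds with V_n the set of oracles in some batch for n. In both     *)
(* cases a random z computes the halting problem: if j enters it after the     *)
(* stage at which z shows up in some U_k with k >= j, then z is captured by a  *)
(* Martin-Loef test (Franklin and Ng).                                         *)
Require Import Defs.
From Stdlib Require Cantor.
From mathcomp Require Import all_boot all_order all_algebra.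
From mathcomp Require Import all_classical all_reals.
From mathcomp Require Import ereal exp.
From mathcomp Require Import zify lra.

Set Implicit Arguments.
Unset Strict Implicit.
Unset Printing Implicit Defensive.

(** * Closure properties of Turing reducibility *)

(** Two ingredients are combined. The first, [difference_test], is a principle of Franklin and Ng.
    Take uniformly c.e. open sets [Uu k] and [Vv k] such that each stage of [Uu k] exceeds [Vv k] in
    measure by at most 2^-k. Suppose a random [z] enters [Uu k] for infinitely many [k], but never
    the corresponding [Vv k]. Given [j], let [z] search for a stage at which it is seen in some
    [Uu k] with [k >= j]. If [j] enters the halting set at a later stage [s], then [z] lies in the
    union over [j <= k <= s] of [Uu k] at stage [s] minus [Vv k]. That union has measure at most 2 *
    2^-j, so summing over [j] gives a Martin-Loef test ([cnt_dtest], [dtest_ml]). Hence with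
    finitely many exceptions the stage found decides whether [j] halts. The second ingredient is a
    pair of difference tests, obtained by running the reductions of [g] and [T] on all oracles X.
    [U1 n] waits for g^X to reach [threshold n], and [V1 n] collects the snapshots of [U1 n] taken
    whenever its measure passes a multiple of 2^-n ([U1V1_small]). If [z] avoids [V1 n] for almost
    all [n], this pair already suffices. Otherwise [z] lies in infinitely many snapshots, say one
    closed at stage [m]. The width of level [m] is the same computable number for every oracle
    considered, so an averaging argument ([hitting_set]) gives a single list of about (k+1) 2^m /
    w(m) strings of length [m] that meets level [m] of T^X for nearly all X in the snapshot. [U2]
    and [V2] record the oracles whose level has appeared and those that are hit ([U2V2_small]). A
    string of [T] on the list has a description so short that its deficiency contradicts the assumed
    bound on [g] ([decode_prefix], [V2_out]). So [z] is never hit, and the principle applies to [U2]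
    and [V2]. *)

Lemma nfst_npair x y : nfst (npair x y) = x.
Proof. by rewrite /nfst /npair Cantor.cancel_of_to. Qed.

Lemma nsnd_npair x y : nsnd (npair x y) = y.
Proof. by rewrite /nsnd /npair Cantor.cancel_of_to. Qed.

Lemma npair_eta x : npair (nfst x) (nsnd x) = x.
Proof. by rewrite /nfst /nsnd /npair -surjective_pairing Cantor.cancel_to_of. Qed.

Definition npairE := (nfst_npair, nsnd_npair).

Lemma leq_npair_add x y : y + x <= npair x y.
Proof. by apply/leP; exact: Cantor.to_nat_non_decreasing. Qed.

Lemma leq_npairl x y : x <= npair x y.
Proof. by apply: leq_trans (leq_npair_add x y); rewrite leq_addl. Qed.

Lemma leq_npairr x y : y <= npair x y.
Proof. by apply: leq_trans (leq_npair_add x y); rewrite leq_addr. Qed.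

Lemma leq_npair x y x' y' : x <= x' -> y <= y' -> npair x y <= npair x' y'.
Proof.
move=> hx hy; have := Cantor.to_nat_spec x y; have := Cantor.to_nat_spec x' y'.
rewrite -/(npair x y) -/(npair x' y') => e1 e2.
have : (y + x) * (y + x).+1 <= (y' + x') * (y' + x').+1 by apply: leq_mul; lia.
lia.
Qed.

Lemma leq_nfst x : nfst x <= x.
Proof. by rewrite -{2}(npair_eta x) leq_npairl. Qed.

Lemma leq_nsnd x : nsnd x <= x.
Proof. by rewrite -{2}(npair_eta x) leq_npairr. Qed.

Lemma run_det o c x y y' : run o c x y -> run o c x y' -> y = y'.
Proof.
elim: c x y y' => //=; try by move=> x y y' -> ->.
- move=> c1 h1 c2 h2 x y y' [y1 [y2 [r1 r2 ->]]] [z1 [z2 [s1 s2 ->]]].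
  by rewrite (h1 _ _ _ r1 s1) (h2 _ _ _ r2 s2).
- move=> c1 h1 c2 h2 x y y' [u r1 r2] [u' s1 s2].
  by move: r2; rewrite (h2 _ _ _ r1 s1) => r2; apply: h1 r2 s2.
- move=> c1 h1 c2 h2 x; elim: (nsnd x) => [|n IH] y y' /=; first exact: h1.
  move=> [r r1 r2] [r' s1 s2].
  by move: r2; rewrite (IH _ _ r1 s1) => r2; apply: h2 r2 s2.
- move=> c1 h1 x y y' [r0 rm] [s0 sm].
  case: (ltngtP y y') => // [/sm|/rm] [k hk].
    by have := h1 _ _ _ r0 hk.
  by have := h1 _ _ _ s0 hk.
Qed.

Lemma turing_leP f o : turing_le f o ->
  exists c, forall x y, run o c x y <-> y = f x.
Proof.
move=> [c hc]; exists c => x y; split=> [h|->]; last exact: hc.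
exact: run_det h (hc x).
Qed.

Lemma turing_le_ext f g o : f =1 g -> turing_le f o -> turing_le g o.
Proof. by move=> /funext ->. Qed.

Lemma tl_id o : turing_le (fun x => x) o.
Proof.
exists (PPair PFst PSnd) => n /=; exists (nfst n), (nsnd n).
by rewrite npair_eta.
Qed.

Lemma tl_comp o f a : turing_le f o -> turing_le a o ->
  turing_le (fun x => f (a x)) o.
Proof. by move=> [c hc] [d hd]; exists (PComp c d) => n; exists (a n). Qed.

Lemma tl_fst o : turing_le nfst o.
Proof. by exists PFst. Qed.

Lemma tl_snd o : turing_le nsnd o.
Proof. by exists PSnd. Qed.

Lemma tl_S o : turing_le succn o.
Proof. by exists PSucc. Qed.

Lemma tl_nfst o a : turing_le a o -> turing_le (fun x => nfst (a x)) o.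
Proof. by apply: tl_comp; exists PFst. Qed.

Lemma tl_nsnd o a : turing_le a o -> turing_le (fun x => nsnd (a x)) o.
Proof. by apply: tl_comp; exists PSnd. Qed.

Lemma tl_succ o a : turing_le a o -> turing_le (fun x => (a x).+1) o.
Proof. by apply: tl_comp; exists PSucc. Qed.

Lemma tl_const o n : turing_le (fun=> n) o.
Proof. by elim: n => [|n IH]; [exists PZero | apply: tl_succ]. Qed.

Lemma tl_npair o a b : turing_le a o -> turing_le b o ->
  turing_le (fun x => npair (a x) (b x)) o.
Proof. by move=> [c hc] [d hd]; exists (PPair c d) => n; exists (a n), (b n). Qed.

Lemma tl_comp2 o F a b : turing_le (fun p => F (nfst p) (nsnd p)) o ->
  turing_le a o -> turing_le b o -> turing_le (fun x => F (a x) (b x)) o.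
Proof.
move=> hF ha hb; apply: turing_le_ext (tl_comp hF (tl_npair ha hb)) => x.
by rewrite !npairE.
Qed.

Lemma tl_comp3 o F a b c :
  turing_le (fun p => F (nfst p) (nfst (nsnd p)) (nsnd (nsnd p))) o ->
  turing_le a o -> turing_le b o -> turing_le c o ->
  turing_le (fun x => F (a x) (b x) (c x)) o.
Proof.
move=> hF ha hb hc.
apply: turing_le_ext (tl_comp hF (tl_npair ha (tl_npair hb hc))) => x.
by rewrite !npairE.
Qed.

(** * Primitive recursion, and proof search for computability goals *)

Fixpoint prec (n a : nat) (G : nat -> nat -> nat) : nat :=
  if n is m.+1 then G m (prec m a G) else a.

Lemma tl_prec o b a G : turing_le b o -> turing_le a o ->
  turing_le (fun p => G (nfst p) (nfst (nsnd p)) (nsnd (nsnd p))) o ->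
  turing_le (fun x => prec (b x) (a x) (fun i r => G x i r)) o.
Proof.
move=> hb [ca ha] [cG hG].
have [c hc] := tl_npair (tl_id o) hb.
exists (PComp (PRec ca cG) c) => x; exists (npair x (b x)); first exact: hc.
rewrite /= !npairE; elim: (b x) => [|n IH] /=; first exact: ha.
exists (prec n (a x) (fun i r => G x i r)) => //.
by have := hG (npair x (npair n (prec n (a x) (fun i r => G x i r)))); rewrite !npairE.
Qed.

Create HintDb tl discriminated.
#[export] Hint Constants Opaque : tl.
#[export] Hint Resolve tl_id tl_const tl_fst tl_snd tl_S tl_nfst tl_nsnd tl_succ tl_npair tl_prec : tl.

(** Computability of a function of several arguments is assumed on packed arguments. Ternary
    patterns are tried before binary ones, and the pattern matching every function comes last. *)
Ltac tl_hyp :=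
  match goal with
  | H : turing_le (fun p => nat_of_bool (?P (nfst p) (nfst (nsnd p)) (nsnd (nsnd p)))) ?o
    |- turing_le _ ?o => apply (@tl_comp3 o (fun x y z => nat_of_bool (P x y z)) _ _ _ H)
  | H : turing_le (fun p => ?F (nfst p) (nfst (nsnd p)) (nsnd (nsnd p))) ?o
    |- turing_le _ ?o => apply (@tl_comp3 o F _ _ _ H)
  | H : turing_le (fun p => nat_of_bool (?P (nfst p) (nsnd p))) ?o
    |- turing_le _ ?o => apply (@tl_comp2 o (fun x y => nat_of_bool (P x y)) _ _ H)
  | H : turing_le (fun p => ?F (nfst p) (nsnd p)) ?o
    |- turing_le _ ?o => apply (@tl_comp2 o F _ _ H)
  | H : turing_le ?f ?o |- turing_le _ ?o => exact H || apply (tl_comp H)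
  end.
#[export] Hint Extern 5 (turing_le _ _) => tl_hyp : tl.

Ltac tl := solve [typeclasses eauto 1000 with tl nocore].

Lemma tl_add o a b : turing_le a o -> turing_le b o ->
  turing_le (fun x => a x + b x) o.
Proof.
move=> ha hb; apply: (@turing_le_ext (fun x => prec (b x) (a x) (fun i r => r.+1))).
  by move=> x; elim: (b x) => [|n IH] /=; rewrite ?addn0 ?addnS ?IH.
tl.
Qed.
#[export] Hint Resolve tl_add : tl.

Lemma tl_pred o a : turing_le a o -> turing_le (fun x => (a x).-1) o.
Proof.
move=> ha; apply: (@turing_le_ext (fun x => prec (a x) 0 (fun i r => i))).
  by move=> x; case: (a x).
tl.
Qed.
#[export] Hint Resolve tl_pred : tl.

Lemma tl_sub o a b : turing_le a o -> turing_le b o ->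
  turing_le (fun x => a x - b x) o.
Proof.
move=> ha hb; apply: (@turing_le_ext (fun x => prec (b x) (a x) (fun i r => r.-1))).
  by move=> x; elim: (b x) => [|n IH] /=; rewrite ?subn0 ?subnS ?IH.
tl.
Qed.
#[export] Hint Resolve tl_sub : tl.

Lemma tl_mul o a b : turing_le a o -> turing_le b o ->
  turing_le (fun x => a x * b x) o.
Proof.
move=> ha hb; apply: (@turing_le_ext (fun x => prec (b x) 0 (fun i r => a x + r))).
  by move=> x; elim: (b x) => [|n IH] /=; rewrite ?muln0 ?mulnS ?IH.
tl.
Qed.
#[export] Hint Resolve tl_mul : tl.

Lemma tl_exp o a b : turing_le a o -> turing_le b o ->
  turing_le (fun x => a x ^ b x) o.
Proof.
move=> ha hb; apply: (@turing_le_ext (fun x => prec (b x) 1 (fun i r => a x * r))).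
  by move=> x; elim: (b x) => [|n IH] /=; rewrite ?expn0 ?expnS ?IH.
tl.
Qed.
#[export] Hint Resolve tl_exp : tl.

Lemma tl_eq0 o a : turing_le a o -> turing_le (fun x => nat_of_bool (a x == 0)) o.
Proof.
move=> ha; apply: (@turing_le_ext (fun x => 1 - a x)); last by tl.
by move=> x; case: (a x) => [|n] //=; rewrite subSS sub0n.
Qed.

Lemma tl_leq o a b : turing_le a o -> turing_le b o ->
  turing_le (fun x => nat_of_bool (a x <= b x)) o.
Proof. by move=> ha hb; apply: tl_eq0; apply: tl_sub. Qed.
#[export] Hint Resolve tl_leq : tl.

Lemma tl_neg o P : turing_le (fun x => nat_of_bool (P x)) o ->
  turing_le (fun x => nat_of_bool (~~ P x)) o.
Proof.
move=> ha; apply: (@turing_le_ext (fun x => 1 - P x)); last by tl.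
by move=> x; case: (P x).
Qed.
#[export] Hint Resolve tl_neg : tl.

Lemma tl_and o P Q : turing_le (fun x => nat_of_bool (P x)) o ->
  turing_le (fun x => nat_of_bool (Q x)) o ->
  turing_le (fun x => nat_of_bool (P x && Q x)) o.
Proof.
move=> hP hQ; apply: (@turing_le_ext (fun x => P x * Q x)); last by tl.
by move=> x; case: (P x); case: (Q x).
Qed.
#[export] Hint Resolve tl_and : tl.

Lemma tl_or o P Q : turing_le (fun x => nat_of_bool (P x)) o ->
  turing_le (fun x => nat_of_bool (Q x)) o ->
  turing_le (fun x => nat_of_bool (P x || Q x)) o.
Proof.
move=> hP hQ; apply: (@turing_le_ext (fun x => ~~ (~~ P x && ~~ Q x))); last by tl.
by move=> x; case: (P x); case: (Q x).
Qed.
#[export] Hint Resolve tl_or : tl.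

Lemma tl_eq o a b : turing_le a o -> turing_le b o ->
  turing_le (fun x => nat_of_bool (a x == b x)) o.
Proof.
move=> ha hb; apply: (@turing_le_ext (fun x => (a x <= b x) && (b x <= a x))); last by tl.
by move=> x; rewrite eqn_leq.
Qed.
#[export] Hint Resolve tl_eq : tl.

Lemma tl_if o P a b : turing_le (fun x => nat_of_bool (P x)) o ->
  turing_le a o -> turing_le b o ->
  turing_le (fun x => if P x then a x else b x) o.
Proof.
move=> hP ha hb.
apply: (@turing_le_ext (fun x => P x * a x + ~~ P x * b x)); last by tl.
by move=> x; case: (P x); rewrite ?mul0n ?mul1n ?addn0.
Qed.

Lemma tl_ifb o P Q1 Q2 : turing_le (fun x => nat_of_bool (P x)) o ->
  turing_le (fun x => nat_of_bool (Q1 x)) o ->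
  turing_le (fun x => nat_of_bool (Q2 x)) o ->
  turing_le (fun x => nat_of_bool (if P x then Q1 x else Q2 x)) o.
Proof.
move=> hP h1 h2.
apply: (@turing_le_ext (fun x => (P x && Q1 x) || (~~ P x && Q2 x))); last by tl.
by move=> x; case: (P x); rewrite ?orbF.
Qed.
#[export] Hint Resolve tl_if tl_ifb : tl.

(** * Bounded sums, quantifiers and least witnesses *)

Definition bsum (n : nat) (F : nat -> nat) : nat := \sum_(i < n) F i.
Definition bexists (n : nat) (P : nat -> bool) : bool := has P (iota 0 n).
Definition bforall (n : nat) (P : nat -> bool) : bool := all P (iota 0 n).
Definition least (P : nat -> bool) (n : nat) : bool :=
  P n && bforall n (fun m => ~~ P m).

Lemma bexistsP n (P : nat -> bool) : reflect (exists2 i, i < n & P i) (bexists n P).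
Proof.
by apply: (iffP hasP) => -[i hi hP]; exists i => //; move: hi; rewrite mem_iota add0n.
Qed.

Lemma bforallP n (P : nat -> bool) : reflect (forall i, i < n -> P i) (bforall n P).
Proof.
by apply: (iffP allP) => h i hi; apply: h; move: hi; rewrite mem_iota add0n.
Qed.

Lemma leastP (P : nat -> bool) n :
  reflect (P n /\ forall m, m < n -> ~~ P m) (least P n).
Proof. by apply: (iffP andP) => -[hn /bforallP hm]; split=> //; apply/bforallP. Qed.

Lemma least_ex (P : nat -> bool) n : P n -> exists2 m, m <= n & least P m.
Proof.
move=> hn; have hex : exists n, P n by exists n.
case: (ex_minnP hex) => m hm hmin; exists m; first exact: hmin.
by apply/leastP; split=> // i hi; apply/negP => /hmin; rewrite leqNgt hi.
Qed.

Lemma least_uniq (P : nat -> bool) m n : least P m -> least P n -> m = n.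
Proof.
move=> /leastP[hm hm'] /leastP[hn hn'].
by case: (ltngtP m n) => // [/hn'|/hm'] /negP.
Qed.

Lemma tl_bsum o b F : turing_le b o -> turing_le (fun p => F (nfst p) (nsnd p)) o ->
  turing_le (fun x => bsum (b x) (fun i => F x i)) o.
Proof.
move=> hb hF.
apply: (@turing_le_ext (fun x => prec (b x) 0 (fun i r => r + F x i))); last by tl.
by move=> x; rewrite /bsum; elim: (b x) => [|n IH] /=; rewrite ?big_ord0 // big_ord_recr IH.
Qed.
#[export] Hint Resolve tl_bsum : tl.

Lemma tl_bexists o b P : turing_le b o ->
  turing_le (fun p => nat_of_bool (P (nfst p) (nsnd p))) o ->
  turing_le (fun x => nat_of_bool (bexists (b x) (fun i => P x i))) o.
Proof.
move=> hb hP.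
apply: (@turing_le_ext (fun x => 0 < bsum (b x) (fun i => P x i))); last by tl.
move=> x; congr nat_of_bool; apply/idP/bexistsP.
  rewrite /bsum lt0n sum_nat_eq0 negb_forall => /existsP[i].
  by rewrite /= eqb0 negbK => hi; exists i.
move=> [i hi hP']; rewrite /bsum lt0n sum_nat_eq0 negb_forall; apply/existsP.
by exists (Ordinal hi); rewrite /= hP'.
Qed.
#[export] Hint Resolve tl_bexists : tl.

Lemma tl_bforall o b P : turing_le b o ->
  turing_le (fun p => nat_of_bool (P (nfst p) (nsnd p))) o ->
  turing_le (fun x => nat_of_bool (bforall (b x) (fun i => P x i))) o.
Proof.
move=> hb hP.
apply: (@turing_le_ext (fun x => ~~ bexists (b x) (fun i => ~~ P x i))); last by tl.
by move=> x; rewrite /bexists /bforall has_predC negbK.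
Qed.
#[export] Hint Resolve tl_bforall : tl.

Lemma tl_least o b P : turing_le b o ->
  turing_le (fun p => nat_of_bool (P (nfst p) (nsnd p))) o ->
  turing_le (fun x => nat_of_bool (least (fun i => P x i) (b x))) o.
Proof. by move=> hb hP; rewrite /least; tl. Qed.
#[export] Hint Resolve tl_least : tl.

Lemma tl_div o a b : turing_le a o -> turing_le b o ->
  turing_le (fun x => a x %/ b x) o.
Proof.
move=> ha hb.
apply: (@turing_le_ext (fun x => bsum (a x) (fun i => (0 < b x) && (i.+1 * b x <= a x)))); last by tl.
move=> x; rewrite /bsum; case: (posnP (b x)) => [->|hpos] /=.
  by rewrite divn0 big1.
under eq_bigr => i _ do rewrite -leq_divRL //.
rewrite -(big_mkord xpredT (fun i => (i < a x %/ b x : nat))).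
rewrite (@big_cat_nat _ _ _ (a x %/ b x)) //=; last exact: leq_div.
rewrite big_nat (eq_bigr (fun=> 1)) => [|i /andP[_ ->] //].
rewrite -big_nat sum_nat_const_nat subn0 muln1 big_nat big1 ?addn0 // => i.
by move=> /andP[h _]; rewrite ltnNge h.
Qed.
#[export] Hint Resolve tl_div : tl.

Lemma tl_mod o a b : turing_le a o -> turing_le b o ->
  turing_le (fun x => a x %% b x) o.
Proof.
move=> ha hb; apply: (@turing_le_ext (fun x => a x - a x %/ b x * b x)); last by tl.
by move=> x; rewrite {1}(divn_eq (a x) (b x)) addKn.
Qed.
#[export] Hint Resolve tl_mod : tl.

(** Since [no_oracle] is constantly zero, replacing [POracle] by [PZero] removes all oracle
    calls. *)
Lemma computable_turing_le f o : computable f -> turing_le f o.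
Proof.
move=> [c hc].
pose fix tr c := match c with
  | POracle => PZero
  | PPair c1 c2 => PPair (tr c1) (tr c2)
  | PComp c1 c2 => PComp (tr c1) (tr c2)
  | PRec c1 c2 => PRec (tr c1) (tr c2)
  | PMin c1 => PMin (tr c1)
  | c => c end.
suff trE d x y : run no_oracle d x y -> run o (tr d) x y by exists (tr c) => n; apply: trE.
elim: d x y => //=.
- move=> c1 h1 c2 h2 x y [y1 [y2 [r1 r2 e]]].
  by exists y1, y2; split; [apply: h1|apply: h2|].
- by move=> c1 h1 c2 h2 x y [u r1 r2]; exists u; [apply: h2|apply: h1].
- move=> c1 h1 c2 h2 x; elim: (nsnd x) => [|n IH] y /=; first exact: h1.
  by move=> [r r1 r2]; exists r; [apply: IH|apply: h2].
- move=> c1 h1 x y [h0 hm]; split; first exact: h1.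
  by move=> m /hm [k hk]; exists k; apply: h1.
Qed.

(** No witness is assumed to exist: the program diverges exactly where the search fails, so this
    also yields c.e. sets and partial machines. *)
Lemma pmin_run o P : turing_le (fun p => nat_of_bool (P (nfst p) (nsnd p))) o ->
  exists c, forall x y, run o c x y <-> least (P x) y.
Proof.
move=> hP; have /turing_leP[c hc] := tl_neg hP.
exists (PMin c) => x y /=; rewrite hc !npairE; split.
  move=> [h0 hm]; apply/leastP; split; first by case: (P x y) h0.
  by move=> m /hm [k]; rewrite hc !npairE; case: (P x m).
move=> /leastP[h0 hm]; split; first by rewrite h0.
by move=> m /hm hn; exists 0; rewrite hc !npairE hn.
Qed.

(** * Finite oracles and certificates of computations *)

Definition bit (v j : nat) : nat := (v %/ 2 ^ j) %% 2.

Lemma tl_bit o a b : turing_le a o -> turing_le b o ->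
  turing_le (fun x => bit (a x) (b x)) o.
Proof. by move=> ha hb; rewrite /bit; tl. Qed.
#[export] Hint Resolve tl_bit : tl.

Lemma bit_mod v s j : j < s -> bit (v %% 2 ^ s) j = bit v j.
Proof.
move=> hj; rewrite /bit {2}(divn_eq v (2 ^ s)).
have -> : 2 ^ s = 2 ^ (s - j.+1) * 2 * 2 ^ j.
  by rewrite -mulnA -expnS -expnD subnK.
rewrite mulnA divnMDl ?expn_gt0 // mulnA.
by rewrite modnMDl.
Qed.

Lemma modn_exp2 v s m : m <= s -> v %% 2 ^ s %% 2 ^ m = v %% 2 ^ m.
Proof. by move=> h; rewrite modn_dvdm // dvdn_exp2l. Qed.

(** An initial segment is coded with the least significant bit first, so that shortening an oracle
    from any length to [s] is reduction modulo [2 ^ s]. *)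
Definition pre (x : real) (s : nat) : nat := bsum s (fun j => x j * 2 ^ j).

Lemma preS x s : pre x s.+1 = pre x s + x s * 2 ^ s.
Proof. by rewrite /pre /bsum big_ord_recr. Qed.

Lemma ltn_pre x s : pre x s < 2 ^ s.
Proof.
elim: s => [|s IH]; first by rewrite /pre /bsum big_ord0.
rewrite preS expnS; case: (x s); lia.
Qed.

Lemma pre_mod x s s' : s <= s' -> pre x s' %% 2 ^ s = pre x s.
Proof.
elim: s' => [|s' IH]; first by rewrite leqn0 => /eqP->; rewrite modn_small ?ltn_pre.
rewrite leq_eqVlt => /orP[/eqP->|]; first by rewrite modn_small ?ltn_pre.
rewrite ltnS => h; rewrite preS -{3}(subnK h) expnD mulnA addnC modnMDl.
exact: IH.
Qed.

Lemma bit_pre x s j : j < s -> bit (pre x s) j = x j.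
Proof.
move=> hj; rewrite -(bit_mod _ (ltnSn j)) pre_mod // preS /bit addnC.
rewrite divnMDl ?expn_gt0 // divn_small ?ltn_pre // addn0.
by case: (x j).
Qed.

Lemma tl_pre x a : turing_le a (chi x) -> turing_le (fun n => pre x (a n)) (chi x).
Proof.
move=> ha; have hx : turing_le (fun n => nat_of_bool (x n)) (chi x) by exists POracle.
rewrite /pre; tl.
Qed.
#[export] Hint Resolve tl_pre : tl.

(* A number codes a finite list of nonnegative integers: 0 is the empty list. *)
Definition ccons (t c : nat) : nat := (npair t c).+1.
Definition cdrop (j c : nat) : nat := prec j c (fun _ r => nsnd r.-1).
Definition cmem (t c : nat) : bool :=
  bexists c (fun j => (0 < cdrop j c) && (nfst (cdrop j c).-1 == t)).

Lemma tl_cdrop o a b : turing_le a o -> turing_le b o ->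
  turing_le (fun x => cdrop (a x) (b x)) o.
Proof. by move=> ha hb; rewrite /cdrop; tl. Qed.
#[export] Hint Resolve tl_cdrop : tl.

Lemma tl_cmem o a b : turing_le a o -> turing_le b o ->
  turing_le (fun x => nat_of_bool (cmem (a x) (b x))) o.
Proof. by move=> ha hb; rewrite /cmem; tl. Qed.
#[export] Hint Resolve tl_cmem : tl.

Lemma ccons_ind (P : nat -> Prop) :
  P 0 -> (forall t c, P c -> P (ccons t c)) -> forall c, P c.
Proof.
move=> h0 hS c; elim/ltn_ind: c => -[|n] IH //.
rewrite -(npair_eta n); apply: hS; apply: IH.
by rewrite ltnS leq_nsnd.
Qed.

Lemma cdropS j c : cdrop j.+1 c = nsnd (cdrop j c).-1.
Proof. by []. Qed.

Lemma cdrop_cons j t c : cdrop j.+1 (ccons t c) = cdrop j c.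
Proof.
elim: j => [|j IH]; first by rewrite /cdrop /= nsnd_npair.
by rewrite cdropS IH.
Qed.

(** Tails strictly decrease until they reach 0. Thus [c] itself bounds the length of the list coded
    by [c], which is why [cmem] and [cvalid] search [c] positions. *)
Lemma leq_cdrop j c : cdrop j c <= c - j.
Proof.
elim: j => [|j IH]; first by rewrite subn0.
rewrite cdropS (leq_trans (leq_nsnd _)) // subnS.
by case: (cdrop j c) IH => // n h; rewrite -!subn1 leq_sub2r.
Qed.

Lemma ltn_ccons t c : c < ccons t c.
Proof. by rewrite ltnS leq_npairr. Qed.

Lemma cmem_cons t u c : cmem t (ccons u c) = (t == u) || cmem t c.
Proof.
apply/bexistsP/orP => [[[|j] hj]|].
- by rewrite /cdrop /= nfst_npair eq_sym; left.
- rewrite cdrop_cons => h; right; apply/bexistsP; exists j => //.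
  by case/andP: h => h _; move: (leq_cdrop j c) => h'; lia.
- case=> [/eqP->|/bexistsP[j hj h]]; first by exists 0; rewrite //= /cdrop /= nfst_npair.
  by exists j.+1; rewrite ?cdrop_cons // (leq_trans _ (ltn_ccons _ _)).
Qed.

Lemma cmem_ltn t c : cmem t c -> t < c.
Proof.
elim/ccons_ind: c => // u c IH; rewrite cmem_cons => /orP[/eqP->|/IH h].
  by rewrite ltnS leq_npairl.
exact: ltn_trans h (ltn_ccons _ _).
Qed.

Definition trip (e x y : nat) : nat := npair e (npair x y).

Lemma cmem_trip_ltn e x y c : cmem (trip e x y) c -> y < c.
Proof.
move=> /cmem_ltn; apply: leq_ltn_trans.
by apply: leq_trans (leq_npairr _ _); exact: leq_npairr.
Qed.

(* [just s v c e x y]: that program number e maps x to y, with the s bits of v *)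
(* as oracle, follows in one step from the statements listed in c.             *)
Definition just (s v c e x y : nat) : bool :=
  let q := (e - 5) %/ 4 in let r := (e - 5) %% 4 in
  if e == 0 then y == 0
  else if e == 1 then y == x.+1
  else if e == 2 then y == nfst x
  else if e == 3 then y == nsnd x
  else if e == 4 then (x < s) && (y == bit v x)
  else if r == 0 then cmem (trip (nfst q) x (nfst y)) c && cmem (trip (nsnd q) x (nsnd y)) c
  else if r == 1 then
    bexists c (fun u => cmem (trip (nsnd q) x u) c && cmem (trip (nfst q) u y) c)
  else if r == 2 then
    if nsnd x == 0 then cmem (trip (nfst q) (nfst x) y) c
    else bexists c (fun u => cmem (trip e (npair (nfst x) (nsnd x).-1) u) c
           && cmem (trip (nsnd q) (npair (nfst x) (npair (nsnd x).-1 u)) y) c)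
  else cmem (trip q (npair x y) 0) c
       && bforall y (fun m => bexists c (fun k => cmem (trip q (npair x m) k.+1) c)).

(** Each entry is justified by the tail after it, so a valid list is a well-founded derivation. *)
Definition cvalid (s v c : nat) : bool :=
  bforall c (fun j => let d := cdrop j c in let t := nfst d.-1 in
    (d == 0) || just s v (nsnd d.-1) (nfst t) (nfst (nsnd t)) (nsnd (nsnd t))).

(** The stage [s] bounds both the certificate and, through [just], the oracle queries; convergence
    at a stage is therefore decidable and depends on a finite part of the oracle. *)
Definition conv (e x y s v : nat) : bool :=
  bexists s (fun c => cvalid s v c && cmem (trip e x y) c).

Lemma tl_trip o a b c : turing_le a o -> turing_le b o -> turing_le c o ->
  turing_le (fun x => trip (a x) (b x) (c x)) o.
Proof. by move=> ha hb hc; rewrite /trip; tl. Qed.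
#[export] Hint Resolve tl_trip : tl.

Lemma tl_just o a1 a2 a3 a4 a5 a6 :
  turing_le a1 o -> turing_le a2 o -> turing_le a3 o ->
  turing_le a4 o -> turing_le a5 o -> turing_le a6 o ->
  turing_le (fun x => nat_of_bool (just (a1 x) (a2 x) (a3 x) (a4 x) (a5 x) (a6 x))) o.
Proof. by move=> h1 h2 h3 h4 h5 h6; rewrite /just; tl. Qed.
#[export] Hint Resolve tl_just : tl.

Lemma tl_cvalid o a1 a2 a3 :
  turing_le a1 o -> turing_le a2 o -> turing_le a3 o ->
  turing_le (fun x => nat_of_bool (cvalid (a1 x) (a2 x) (a3 x))) o.
Proof. by move=> h1 h2 h3; rewrite /cvalid; tl. Qed.
#[export] Hint Resolve tl_cvalid : tl.

Lemma tl_conv o a1 a2 a3 a4 a5 :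
  turing_le a1 o -> turing_le a2 o -> turing_le a3 o ->
  turing_le a4 o -> turing_le a5 o ->
  turing_le (fun x => nat_of_bool (conv (a1 x) (a2 x) (a3 x) (a4 x) (a5 x))) o.
Proof. by move=> h1 h2 h3 h4 h5; rewrite /conv; tl. Qed.
#[export] Hint Resolve tl_conv : tl.

Lemma cvalid_cons s v t c : cvalid s v (ccons t c) =
  just s v c (nfst t) (nfst (nsnd t)) (nsnd (nsnd t)) && cvalid s v c.
Proof.
apply/bforallP/andP => [h|[h0 /bforallP hc]].
  split; first by have := h 0 (ltn0Sn _); rewrite /cdrop /= !npairE.
  apply/bforallP => j hj; have := h j.+1 (leq_trans hj (leq_npairr t c)).
  by rewrite cdrop_cons.
move=> [|j] hj; first by rewrite /cdrop /= !npairE.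
rewrite cdrop_cons; case: (ltnP j c) => [/hc //|h].
by have := leq_cdrop j c; rewrite (eqP h) leqn0 => /eqP->.
Qed.

Lemma cvalid_trip s v e x y c : cvalid s v (ccons (trip e x y) c) =
  just s v c e x y && cvalid s v c.
Proof. by rewrite cvalid_cons /trip !npairE. Qed.

Lemma just_mono s v c e x y s' v' c' :
  s <= s' -> (forall j, j < s -> bit v' j = bit v j) ->
  (forall t, cmem t c -> cmem t c') -> just s v c e x y -> just s' v' c' e x y.
Proof.
move=> hs hv hc; rewrite /just.
case: ifP => // _; case: ifP => // _; case: ifP => // _; case: ifP => // _.
case: ifP => _; first by move=> /andP[h1 /eqP->]; rewrite hv // eqxx (leq_trans h1 hs).
case: ifP => _; first by move=> /andP[/hc-> /hc->].
case: ifP => _.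
  move=> /bexistsP[u _ /andP[/hc h1 /hc h2]]; apply/bexistsP; exists u; last by rewrite h1.
  exact: cmem_trip_ltn h1.
case: ifP => _.
  case: ifP => _; first exact: hc.
  move=> /bexistsP[u _ /andP[/hc h1 /hc h2]]; apply/bexistsP; exists u; last by rewrite h1.
  exact: cmem_trip_ltn h1.
move=> /andP[/hc -> /bforallP h]; apply/bforallP => m /h /bexistsP[k _ /hc h'].
by apply/bexistsP; exists k => //; apply: ltn_trans (cmem_trip_ltn h').
Qed.

Lemma cvalid_mono s v s' v' c : s <= s' -> (forall j, j < s -> bit v' j = bit v j) ->
  cvalid s v c -> cvalid s' v' c.
Proof.
move=> hs hv; elim/ccons_ind: c => // t c IH; rewrite !cvalid_cons => /andP[h1 /IH ->].
by rewrite andbT; apply: just_mono h1.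
Qed.

(** A computation seen on a prefix persists on every extension. This is the form in which all sets
    of oracles below are shown to be open and increasing in the stage. *)
Lemma conv_mono e x y s v s' : s <= s' -> conv e x y s (v %% 2 ^ s) -> conv e x y s' v.
Proof.
move=> hs /bexistsP[c hc /andP[h1 h2]]; apply/bexistsP; exists c; first exact: leq_trans hc hs.
by rewrite h2 andbT; apply: cvalid_mono h1 => // j hj; rewrite bit_mod.
Qed.

Lemma dec_code q r : r < 4 -> (5 + r + 4 * q - 5) %/ 4 = q /\ (5 + r + 4 * q - 5) %% 4 = r.
Proof. by lia. Qed.

Lemma justPair s v c q x y : just s v c (5 + 4 * q) x y =
  cmem (trip (nfst q) x (nfst y)) c && cmem (trip (nsnd q) x (nsnd y)) c.
Proof. by rewrite /just (@dec_code q 0 isT).1 (@dec_code q 0 isT).2. Qed.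

Lemma justComp s v c q x y : just s v c (6 + 4 * q) x y =
  bexists c (fun u => cmem (trip (nsnd q) x u) c && cmem (trip (nfst q) u y) c).
Proof. by rewrite /just (@dec_code q 1 isT).1 (@dec_code q 1 isT).2. Qed.

Lemma justRec s v c q x y : just s v c (7 + 4 * q) x y =
  if nsnd x == 0 then cmem (trip (nfst q) (nfst x) y) c
  else bexists c (fun u => cmem (trip (7 + 4 * q) (npair (nfst x) (nsnd x).-1) u) c
         && cmem (trip (nsnd q) (npair (nfst x) (npair (nsnd x).-1 u)) y) c).
Proof. by rewrite /just (@dec_code q 2 isT).1 (@dec_code q 2 isT).2. Qed.

Lemma justMin s v c q x y : just s v c (8 + 4 * q) x y =
  cmem (trip q (npair x y) 0) c
  && bforall y (fun m => bexists c (fun k => cmem (trip q (npair x m) k.+1) c)).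
Proof. by rewrite /just (@dec_code q 3 isT).1 (@dec_code q 3 isT).2. Qed.

Definition agree (o : nat -> nat) (s v : nat) : Prop := forall j, j < s -> bit v j = o j.

Lemma just_sound o s v c d x y : agree o s v -> just s v c (prog_code d) x y ->
  (forall d x y, cmem (trip (prog_code d) x y) c -> run o d x y) -> run o d x y.
Proof.
move=> ho; case: d => [|||||d1 d2|d1 d2|d1 d2|d1] hj hc.
- by move/eqP: hj.
- by move/eqP: hj.
- by move/eqP: hj.
- by move/eqP: hj.
- by move: hj => /andP[h1 /eqP->]; rewrite ho.
- move: hj; rewrite [prog_code _]/= justPair !npairE => /andP[/hc r1 /hc r2].
  by exists (nfst y), (nsnd y); rewrite npair_eta.
- move: hj; rewrite [prog_code _]/= justComp !npairE => /bexistsP[u _ /andP[/hc r1 /hc r2]].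
  by exists u.
- move: hj; rewrite [prog_code _]/= justRec !npairE /=.
  case: (nsnd x) => [|n] /=; first exact: hc.
  move=> /bexistsP[u _ /andP[h1 /hc r2]]; exists u => //.
  by have := hc (PRec d1 d2) _ _ h1; rewrite /= !npairE.
- move: hj; rewrite [prog_code _]/= justMin => /andP[/hc r0 /bforallP hm].
  by split=> // m /hm /bexistsP[k _ /hc rk]; exists k.
Qed.

Lemma conv_sound o s v d x y : agree o s v -> conv (prog_code d) x y s v -> run o d x y.
Proof.
move=> ho /bexistsP[c _ /andP[hv hm]]; elim/ccons_ind: c d x y hv hm => // t c IH d x y.
rewrite cvalid_cons cmem_cons => /andP[hj hc] /orP[/eqP ht|]; last exact: IH.
move: hj; rewrite -ht /trip !npairE => hj; apply: just_sound ho hj _ => d' x' y'.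
exact: IH.
Qed.

(* Derivations are composed by extending an arbitrary initial list c0. *)
Lemma run_cert o d x y : run o d x y -> exists s0, forall c0, exists c,
  (forall t, cmem t c0 -> cmem t c) /\
  forall s v, s0 <= s -> agree o s v -> cvalid s v c0 ->
    cvalid s v c && cmem (trip (prog_code d) x y) c.
Proof.
have base e x' y' s0 : (forall s v c, s0 <= s -> agree o s v -> just s v c e x' y') ->
  exists s0, forall c0, exists c, (forall t, cmem t c0 -> cmem t c) /\
  forall s v, s0 <= s -> agree o s v -> cvalid s v c0 ->
    cvalid s v c && cmem (trip e x' y') c.
  move=> h; exists s0 => c0; exists (ccons (trip e x' y') c0); split.
    by move=> t ht; rewrite cmem_cons ht orbT.
  by move=> s v hs ho hv; rewrite cmem_cons eqxx andbT cvalid_trip hv andbT; apply: h.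
elim: d x y => [|||||d1 h1 d2 h2|d1 h1 d2 h2|d1 h1 d2 h2|d1 h1] x y /=.
- by move=> ->; apply: (base _ _ _ 0).
- by move=> ->; apply: (base _ _ _ 0) => s v c _ _; apply/eqP.
- by move=> ->; apply: (base _ _ _ 0) => s v c _ _; apply/eqP.
- by move=> ->; apply: (base _ _ _ 0) => s v c _ _; apply/eqP.
- move=> ->; apply: (base _ _ _ x.+1) => s v c hs ho.
  by rewrite /just /= hs ho // eqxx.
- move=> [y1 [y2 [/h1[s1 r1] /h2[s2 r2] ->]]]; exists (maxn s1 s2) => c0.
  have [c1 [i1 {}r1]] := r1 c0; have [c2 [i2 {}r2]] := r2 c1.
  exists (ccons (trip (5 + 4 * npair (prog_code d1) (prog_code d2)) x (npair y1 y2)) c2).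
  split=> [t /i1/i2 ht|s v]; first by rewrite cmem_cons ht orbT.
  rewrite geq_max => /andP[hs1 hs2] ho /(r1 _ _ hs1 ho)/andP[v1 m1].
  have /andP[v2 m2] := r2 _ _ hs2 ho v1.
  by rewrite cmem_cons eqxx andbT cvalid_trip v2 justPair !npairE (i2 _ m1) m2.
- move=> [u /h2[s2 r2] /h1[s1 r1]]; exists (maxn s1 s2) => c0.
  have [c1 [i1 {}r1]] := r1 c0; have [c2 [i2 {}r2]] := r2 c1.
  exists (ccons (trip (6 + 4 * npair (prog_code d1) (prog_code d2)) x y) c2).
  split=> [t /i1/i2 ht|s v]; first by rewrite cmem_cons ht orbT.
  rewrite geq_max => /andP[hs1 hs2] ho /(r1 _ _ hs1 ho)/andP[v1 m1].
  have /andP[v2 m2] := r2 _ _ hs2 ho v1.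
  rewrite cmem_cons eqxx andbT cvalid_trip v2 justComp !npairE andbT.
  by apply/bexistsP; exists u; rewrite ?(i2 _ m1) ?m2 // (cmem_trip_ltn m2).
- rewrite -{3}(npair_eta x); elim: (nsnd x) y => [|n IH] y /=.
    move=> /h1[s1 r1]; exists s1 => c0; have [c1 [i1 {}r1]] := r1 c0.
    exists (ccons (trip (7 + 4 * npair (prog_code d1) (prog_code d2)) (npair (nfst x) 0) y) c1).
    split=> [t /i1 ht|s v hs1 ho]; first by rewrite cmem_cons ht orbT.
    move=> /(r1 _ _ hs1 ho)/andP[v1 m1].
    by rewrite cmem_cons eqxx andbT cvalid_trip v1 justRec !npairE /= m1.
  move=> [u /IH[s1 r1] /h2[s2 r2]]; exists (maxn s1 s2) => c0.
  have [c1 [i1 {}r1]] := r1 c0; have [c2 [i2 {}r2]] := r2 c1.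
  exists (ccons (trip (7 + 4 * npair (prog_code d1) (prog_code d2)) (npair (nfst x) n.+1) y) c2).
  split=> [t /i1/i2 ht|s v]; first by rewrite cmem_cons ht orbT.
  rewrite geq_max => /andP[hs1 hs2] ho /(r1 _ _ hs1 ho)/andP[v1 m1].
  have /andP[v2 m2] := r2 _ _ hs2 ho v1.
  rewrite cmem_cons eqxx andbT cvalid_trip v2 justRec !npairE andbT /=.
  by apply/bexistsP; exists u; rewrite ?(i2 _ m1) ?m2 // (cmem_trip_ltn (i2 _ m1)).
- move=> [/h1[s1 r1] hm].
  (* A second induction merges the certificates for all arguments below the minimum into one
     list. *)
  have [s2 r2] : exists s0, forall c0, exists c,
    (forall t, cmem t c0 -> cmem t c) /\
    forall s v, s0 <= s -> agree o s v -> cvalid s v c0 ->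
    cvalid s v c /\ forall m, m < y -> exists k, cmem (trip (prog_code d1) (npair x m) k.+1) c.
    elim: y {r1} hm => [|y IH] hm; first by exists 0 => c0; exists c0.
    have [|s2 r2] := IH; first by move=> m hmy; apply: hm; apply: ltnW.
    have [k /h1[s3 r3]] := hm y (ltnSn y).
    exists (maxn s2 s3) => c0; have [c2 [i2 {}r2]] := r2 c0.
    have [c3 [i3 {}r3]] := r3 c2; exists c3; split=> [t /i2/i3 //|s v].
    rewrite geq_max => /andP[hs2 hs3] ho /(r2 _ _ hs2 ho)[v2 m2].
    have /andP[v3 m3] := r3 _ _ hs3 ho v2; split=> // m.
    rewrite ltnS leq_eqVlt => /orP[/eqP->|/m2[k' /i3 h]]; first by exists k.
    by exists k'.
  exists (maxn s1 s2) => c0.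
  have [c1 [i1 {}r1]] := r1 c0; have [c2 [i2 {}r2]] := r2 c1.
  exists (ccons (trip (8 + 4 * prog_code d1) x y) c2).
  split=> [t /i1/i2 ht|s v]; first by rewrite cmem_cons ht orbT.
  rewrite geq_max => /andP[hs1 hs2] ho /(r1 _ _ hs1 ho)/andP[v1 m1].
  have [v2 m2] := r2 _ _ hs2 ho v1.
  rewrite cmem_cons eqxx andbT cvalid_trip v2 justMin (i2 _ m1) andbT /=.
  apply/bforallP => m /m2[k hk]; apply/bexistsP; exists k => //.
  exact: ltn_trans (cmem_trip_ltn hk).
Qed.

Lemma conv_complete o d x y : run o d x y ->
  exists s0, forall s v, s0 <= s -> agree o s v -> conv (prog_code d) x y s v.
Proof.
move=> /run_cert[s0 /(_ 0)[c [_ hc]]]; exists (maxn s0 c.+1) => s v.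
by rewrite geq_max => /andP[h1 h2] ho; apply/bexistsP; exists c => //; apply: hc.
Qed.

Lemma agree_pre x s : agree (chi x) s (pre x s).
Proof. by move=> j hj; rewrite bit_pre. Qed.

Lemma conv_pre_sound z s d x y : conv (prog_code d) x y s (pre z s) -> run (chi z) d x y.
Proof. by apply: conv_sound; exact: agree_pre. Qed.

Lemma conv_pre_complete z d x y : run (chi z) d x y ->
  exists s0, forall s, s0 <= s -> conv (prog_code d) x y s (pre z s).
Proof.
by move=> /conv_complete[s0 h]; exists s0 => s hs; apply: h => //; exact: agree_pre.
Qed.

(** * The halting problem by stages *)

Lemma prog_code_surj e : exists c, prog_code c = e.
Proof.
elim/ltn_ind: e => e IH.
case: (ltnP e 5) => he.
  move: e {IH} he => [|[|[|[|[|e]]]]] // _.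
  - by exists PZero.
  - by exists PSucc.
  - by exists PFst.
  - by exists PSnd.
  - by exists POracle.
have hq : (e - 5) %/ 4 < e by lia.
have [c1 e1] := IH _ (leq_ltn_trans (leq_nfst _) hq).
have [c2 e2] := IH _ (leq_ltn_trans (leq_nsnd _) hq).
have [c3 e3] := IH _ hq.
have : (e - 5) %% 4 < 4 by lia.
case er : ((e - 5) %% 4) => [|[|[|[|r]]]] // _.
- by exists (PPair c1 c2); rewrite /= e1 e2 npair_eta; lia.
- by exists (PComp c1 c2); rewrite /= e1 e2 npair_eta; lia.
- by exists (PRec c1 c2); rewrite /= e1 e2 npair_eta; lia.
- by exists (PMin c3); rewrite /= e3; lia.
Qed.

(** The oracle value 0 has only zero bits, hence agrees with [no_oracle] to every length. *)
Definition halted (n s : nat) : bool := bexists s (fun y => conv n n y s 0).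

Lemma tl_halted o a b : turing_le a o -> turing_le b o ->
  turing_le (fun x => nat_of_bool (halted (a x) (b x))) o.
Proof. by move=> ha hb; rewrite /halted; tl. Qed.
#[export] Hint Resolve tl_halted : tl.

Lemma agree_no_oracle s : agree no_oracle s 0.
Proof. by move=> j _; rewrite /bit div0n mod0n. Qed.

Lemma halted_mono n s s' : s <= s' -> halted n s -> halted n s'.
Proof.
move=> hs /bexistsP[y hy h]; apply/bexistsP; exists y; first exact: leq_trans hy hs.
by apply: (conv_mono hs); rewrite mod0n.
Qed.

Lemma haltingP n : reflect (exists s, halted n s) (halting n).
Proof.
apply: (iffP (asboolP _)) => [[c [<- [y hy]]]|[s /bexistsP[y _ h]]].
  have [s0 h] := conv_complete hy; exists (maxn s0 y.+1); apply/bexistsP; exists y.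
    exact: leq_maxr.
  by apply: h; [exact: leq_maxl|exact: agree_no_oracle].
have [c hc] := prog_code_surj n; exists c; split=> //; exists y.
by move: h; rewrite -{1}hc; apply: conv_sound; exact: agree_no_oracle.
Qed.

(** * Counting and binary strings *)

Lemma tl_search o P : turing_le (fun p => nat_of_bool (P (nfst p) (nsnd p))) o ->
  (forall x, exists y, P x y) ->
  exists f, turing_le f o /\ forall x, P x (f x).
Proof.
move=> hP hex; have [c hc] := pmin_run hP.
exists (fun x => ex_minn (hex x)); split.
  exists c => x; rewrite hc; case: ex_minnP => y hy hmin; apply/leastP; split=> // m hm.
  by apply/negP => /hmin; rewrite leqNgt hm.
by move=> x; case: ex_minnP.
Qed.

(** Divided by [2 ^ t], this is the uniform measure of the clopen set that [P] defines on the first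
    [t] bits. All measure estimates are stated with denominators cleared. *)
Definition cnt (t : nat) (P : nat -> bool) : nat := bsum (2 ^ t) (fun v => P v).

Lemma tl_cnt o b P : turing_le b o ->
  turing_le (fun p => nat_of_bool (P (nfst p) (nsnd p))) o ->
  turing_le (fun x => cnt (b x) (fun i => P x i)) o.
Proof. by move=> hb hP; rewrite /cnt; tl. Qed.
#[export] Hint Resolve tl_cnt : tl.

Lemma bsum_add a b F : bsum (a + b) F = bsum a F + bsum b (fun i => F (a + i)).
Proof. by rewrite /bsum big_split_ord. Qed.

Lemma leq_bsum n F G : (forall i, i < n -> F i <= G i) -> bsum n F <= bsum n G.
Proof. by move=> h; apply: leq_sum => i _; apply: h. Qed.

Lemma eq_bsum n F G : (forall i, i < n -> F i = G i) -> bsum n F = bsum n G.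
Proof. by move=> h; apply: eq_bigr => i _; apply: h. Qed.

Lemma leq_cnt t (P Q : nat -> bool) : (forall v, v < 2 ^ t -> P v -> Q v) -> cnt t P <= cnt t Q.
Proof. by move=> h; apply: leq_bsum => v /h; case: (P v) (Q v) => [] [] // /(_ isT). Qed.

Lemma cntU t P Q : cnt t (fun v => P v || Q v) <= cnt t P + cnt t Q.
Proof.
by rewrite /cnt /bsum -big_split; apply: leq_sum => v _; case: (P v) (Q v) => [] [].
Qed.

Lemma cnt_max t P : cnt t P <= 2 ^ t.
Proof.
rewrite -[leqRHS]card_ord -sum1_card; apply: leq_sum => v _; exact: leq_b1.
Qed.

Lemma cnt0 t (P : nat -> bool) : (forall v, v < 2 ^ t -> ~~ P v) -> cnt t P = 0.
Proof. by move=> h; apply: big1 => v _; rewrite (negbTE (h _ (ltn_ord v))). Qed.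

Lemma cnt_lift t t' P : t <= t' -> cnt t' (fun v => P (v %% 2 ^ t)) = cnt t P * 2 ^ (t' - t).
Proof.
move=> /subnK <-; rewrite addnK; elim: (t' - t) => [|d IH].
  by rewrite add0n muln1; apply: eq_bsum => v hv; rewrite modn_small.
rewrite addSn /cnt expnS mul2n -addnn bsum_add -/(cnt (d + t) _) IH.
rewrite (eq_bsum (G := fun v => P (v %% 2 ^ t))) => [|v _].
  by rewrite -/(cnt (d + t) _) IH expnS mul2n -addnn mulnDr.
by rewrite expnD modnMDl.
Qed.

Lemma cnt_bexists t n P :
  cnt t (fun v => bexists n (fun k => P k v)) <= bsum n (fun k => cnt t (P k)).
Proof.
elim: n => [|n IH]; first by rewrite cnt0.
rewrite /bsum big_ord_recr /= -/(bsum n (fun k => cnt t (P k))).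
apply: leq_trans (_ : _ <= cnt t (fun v => bexists n (fun k => P k v)) + cnt t (P n)) _.
  apply: leq_trans (cntU _ _ _); apply: leq_cnt => v _ /bexistsP[k].
  rewrite ltnS leq_eqVlt => /orP[/eqP-> h|hk h]; apply/orP; [by right|left].
  by apply/bexistsP; exists k.
by rewrite leq_add2r.
Qed.

Lemma geometric_sum j m M F : (forall k, k < j -> F k = 0) ->
  (forall k, j <= k -> F k * 2 ^ k <= M) -> bsum m F * 2 ^ j <= M * 2.
Proof.
move=> h0 hF; case: (leqP m j) => hm.
  rewrite /bsum big1 // => k _; apply: h0; apply: leq_trans hm; exact: ltn_ord.
(* The induction needs the exact partial sum: the total plus 2M 2^-m is at most 2M 2^-j. *)
suff : bsum m F * 2 ^ (m + j) + M * 2 ^ j.+1 <= M * 2 ^ m.+1.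
  have := expn_gt0 2 m; rewrite expnD !expnS; set a := 2 ^ m; set b := 2 ^ j.
  set S := bsum m F => /= ha h.
  rewrite -(leq_pmul2r ha); nia.
rewrite -(subnK (ltnW hm)); elim: (m - j) => [|d IH].
  rewrite add0n [bsum _ _]big1 // => k _; exact: h0.
rewrite addSn /bsum big_ord_recr /= -/(bsum (d + j) F).
have := hF (d + j) (leq_addl _ _); move: IH.
rewrite addSn !expnS expnD.
set S := bsum _ _; set a := 2 ^ (d + j); set b := 2 ^ j; set f := F _.
move=> h1 h2.
nia.
Qed.

(** * Binary strings as numbers *)

Fixpoint strval (s : bitseq) : nat := if s is b :: s' then b + 2 * strval s' else 0.

Lemma ltn_strval s : strval s < 2 ^ size s.
Proof. by elim: s => //= b s IH; rewrite expnS; case: b; lia. Qed.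

Lemma str_codeE s : (str_code s).+1 = 2 ^ size s + strval s.
Proof. by elim: s => //= b s IH; rewrite expnS; case: b; lia. Qed.

Lemma strval_take n s : n <= size s -> strval (take n s) = strval s %% 2 ^ n.
Proof.
elim: s n => [|b s IH] [|n] //=; rewrite ?modn1 // ltnS => h.
rewrite IH // expnS muln_modr -modnDmr.
rewrite [RHS]modn_small //; have := ltn_pmod (2 * strval s) (expn_gt0 2 n.+1).
rewrite expnS -muln_modr; case: b => //; set a := _ %% _; set c := 2 ^ _; lia.
Qed.

Lemma prefix_strval s t : prefix s t -> strval s = strval t %% 2 ^ size s.
Proof.
move=> /prefixP[r ->]; rewrite -strval_take ?take_size_cat //.
by rewrite size_cat leq_addr.
Qed.

Lemma strval_inj s t : size s = size t -> strval s = strval t -> s = t.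
Proof.
elim: s t => [|b s IH] [|c t] //= [hs] h.
have hbc : b = c by case: b c h => [] [] //; lia.
by rewrite hbc (IH t) //; move: h; rewrite hbc; lia.
Qed.

Lemma strval_mkseq x n : strval (mkseq x n) = pre x n.
Proof.
rewrite /pre; elim: n x => [|n IH] x; first by rewrite /bsum big_ord0.
rewrite /bsum big_ord_recl /= muln1 -[1%N]/(1 + 0) iotaDl -map_comp.
congr addn; rewrite -/(mkseq _ n) IH /bsum big_distrr /=.
by apply: eq_bigr => i _; rewrite expnS mulnCA.
Qed.

Lemma card_strval n P :
  #|[set t : n.-tuple bool | P (strval t)]| = cnt n P.
Proof.
pose f (t : n.-tuple bool) : 'I_(2 ^ n) := Ordinal (eq_ind _ (fun m => strval t < 2 ^ m) (ltn_strval t) _ (size_tuple t)).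
have hf : bijective f.
  apply: inj_card_bij; last by rewrite card_ord card_tuple card_bool.
  move=> s t /(congr1 val) /= h; apply: val_inj; apply: strval_inj h.
  by rewrite !size_tuple.
rewrite -sum1_card big_mkcond /cnt /bsum (reindex f) /=; last exact: onW_bij.
by apply: eq_bigr => t _; rewrite inE; case: (P _).
Qed.

(* Length of the string with code x, and its strval. *)
Definition slen (x : nat) : nat := bsum x (fun l => 2 ^ l.+1 <= x.+1).
Definition scval (x : nat) : nat := x.+1 - 2 ^ slen x.

Lemma tl_slen o a : turing_le a o -> turing_le (fun x => slen (a x)) o.
Proof. by move=> ha; rewrite /slen; tl. Qed.
#[export] Hint Resolve tl_slen : tl.

Lemma tl_scval o a : turing_le a o -> turing_le (fun x => scval (a x)) o.
Proof. by move=> ha; rewrite /scval; tl. Qed.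
#[export] Hint Resolve tl_scval : tl.

Lemma bsum_ltn n m : m <= n -> bsum n (fun l => l < m) = m.
Proof.
move=> /subnKC <-; rewrite bsum_add [X in _ + X]big1 ?addn0 => [|i _].
  rewrite (eq_bsum (G := fun=> 1)) => [|i ->] //.
  by rewrite /bsum sum1_card card_ord.
by rewrite ltnNge leq_addr.
Qed.

Lemma slen_code s : slen (str_code s) = size s.
Proof.
have h := str_codeE s; have hv := ltn_strval s.
rewrite /slen h (eq_bsum (G := fun l => l < size s)) ?bsum_ltn // => [|l _].
  by have := ltn_expl (size s) (ltnSn 1); lia.
congr nat_of_bool; apply/idP/idP => hl.
  rewrite -(leq_exp2l _ _ (ltnSn 1)) leqNgt; apply/negP => hlt.
  have : 2 ^ (size s).+1 <= 2 ^ l.+1.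
    by rewrite leq_exp2l //; move: hlt; rewrite ltn_exp2l.
  by rewrite expnS; lia.
by apply: leq_trans (leq_addr _ _); rewrite leq_exp2l.
Qed.

Lemma scval_code s : scval (str_code s) = strval s.
Proof. by rewrite /scval slen_code str_codeE addKn. Qed.

Lemma str_code_surj x : exists s, str_code s = x.
Proof.
elim/ltn_ind: x => -[|x] IH; first by exists [::].
have [|s hs] := IH x./2; first by rewrite ltnS -divn2 leq_div.
by exists (odd x :: s); rewrite /= hs; have := odd_double_half x; lia.
Qed.

Import Order.TTheory GRing.Theory Num.Theory.

(** * Difference tests *)

(** The quantifier over oracles lets the same sets be used without oracle, for the Martin-Loef test,
    and relative to [z], for the reduction. *)
Definition computable3 (P : nat -> nat -> nat -> bool) : Prop :=
  forall o, turing_le (fun p => nat_of_bool (P (nfst p) (nfst (nsnd p)) (nsnd (nsnd p)))) o.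

Section DifferenceTest.
Variables Uu Vv : nat -> nat -> nat -> bool.
Hypothesis cU : computable3 Uu.
Hypothesis cV : computable3 Vv.
Hypothesis mU : forall k s s' v, s <= s' -> Uu k s (v %% 2 ^ s) -> Uu k s' v.
Hypothesis mV : forall k s s' v, s <= s' -> Vv k s (v %% 2 ^ s) -> Vv k s' v.

Definition dset (k s t v : nat) : bool := Uu k s (v %% 2 ^ s) && ~~ Vv k t v.

Definition dunion (j s t v : nat) : bool :=
  bexists s.+1 (fun k => (j <= k) && dset k s t v).

Definition tame (j s t : nat) : bool :=
  bforall s.+1 (fun k => (k < j) || (cnt t (fun v => dset k s t v) * 2 ^ k <= 2 ^ t)).

(* If j enters the halting set at stage s, the test captures the oracles lying *)
(* in U_k at stage s for some k >= j, once most of those in V_k have left.     *)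
Definition dtest (n t v : nat) : bool :=
  bexists t.+1 (fun j => (n.+2 <= j) && bexists t.+1 (fun s =>
    [&& least (fun i => halted j i) s, tame j s t & dunion j s t v])).

Lemma tl_dset o a1 a2 a3 a4 :
  turing_le a1 o -> turing_le a2 o -> turing_le a3 o -> turing_le a4 o ->
  turing_le (fun x => nat_of_bool (dset (a1 x) (a2 x) (a3 x) (a4 x))) o.
Proof.
move=> h1 h2 h3 h4; rewrite /dset; have := cU o; have := cV o => hV hU; tl.
Qed.
#[local] Hint Resolve tl_dset : tl.

Lemma tl_dtest o a1 a2 a3 : turing_le a1 o -> turing_le a2 o -> turing_le a3 o ->
  turing_le (fun x => nat_of_bool (dtest (a1 x) (a2 x) (a3 x))) o.
Proof. by move=> h1 h2 h3; rewrite /dtest /tame /dunion; tl. Qed.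
#[local] Hint Resolve tl_dtest : tl.

(** With [s] fixed, a later [t] only removes oracles, because [Vv k] grows. *)
Lemma dset_mono k s t t' v : s <= t -> t <= t' ->
  dset k s t' v -> dset k s t (v %% 2 ^ t).
Proof.
move=> hs ht /andP[h1 h2]; apply/andP; split.
  by rewrite modn_exp2.
by apply: contra h2; apply: mV.
Qed.

Lemma dunion_mono j s t t' v : s <= t -> t <= t' ->
  dunion j s t' v -> dunion j s t (v %% 2 ^ t).
Proof.
move=> hs ht /bexistsP[k hk /andP[hjk h]]; apply/bexistsP; exists k => //.
by rewrite hjk; apply: dset_mono h.
Qed.

Lemma cnt_dunion j s t : tame j s t -> cnt t (dunion j s t) * 2 ^ j <= 2 ^ t * 2.
Proof.
move=> /bforallP ht; apply: leq_trans (leq_mul (cnt_bexists _ _ _) (leqnn _)) _.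
pose F k := if k < s.+1 then cnt t (fun v => (j <= k) && dset k s t v) else 0.
rewrite (eq_bsum (G := F)) => [|k hk]; last by rewrite /F hk.
apply: geometric_sum => k hk.
  by rewrite /F; case: ifP => // _; apply: cnt0 => v _; rewrite leqNgt hk.
rewrite /F; case: ifP => [/ht|_]; last by rewrite mul0n.
by rewrite ltnNge hk.
Qed.

(** For each [j] the entry stage [s] is unique, and from the first tame [t0] on the sets
    [dunion j s t] only shrink. So everything captured because of [j] lies in one set, of measure at
    most 2 * 2^-j. Summing over [j >= n + 2] gives 4 * 2^-(n+2) = 2^-n. *)
Lemma cnt_dtest n N :
  cnt N (fun v => bexists N.+1 (fun t => dtest n t (v %% 2 ^ t))) * 2 ^ n <= 2 ^ N.
Proof.
pose W j v := bexists N.+1 (fun t => bexists t.+1 (fun s =>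
  [&& least (fun i => halted j i) s, tame j s t & dunion j s t (v %% 2 ^ t)])).
have hW j : cnt N (W j) * 2 ^ j <= 2 ^ N * 2.
  case: (pselect (exists s t, [&& s <= t, t <= N, least (fun i => halted j i) s & tame j s t])); last first.
    move=> hn; rewrite cnt0 ?mul0n // => v _; apply/negP => /bexistsP[t ht /bexistsP[s hs]].
    move=> /and3P[h1 h2 _]; apply: hn; exists s, t; rewrite h1 h2 !andbT.
    by apply/andP.
  move=> [s [t1 /and4P[hs1 hN1 hl ht1]]].
  have [t0 ht01 /leastP[/andP[hs0 ht0] hmin]] :=
    @least_ex (fun t => (s <= t) && tame j s t) t1 (introT andP (conj hs1 ht1)).
  have hN0 := leq_trans ht01 hN1.
  apply: leq_trans (_ : cnt N (fun v => dunion j s t0 (v %% 2 ^ t0)) * 2 ^ j <= _).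
    rewrite leq_mul2r; apply/orP; right; apply: leq_cnt => v _.
    move=> /bexistsP[t ht /bexistsP[s' hs' /and3P[hl' htt hd]]].
    have es := least_uniq hl hl'; subst s'.
    have h0t : t0 <= t.
      by rewrite leqNgt; apply/negP => /hmin; rewrite htt andbT -ltnS hs'.
    have := dunion_mono hs0 h0t hd.
    by rewrite modn_exp2.
  rewrite cnt_lift // mulnAC; have := cnt_dunion ht0.
  move=> h; apply: leq_trans (leq_mul h (leqnn _)) _.
  by rewrite mulnAC -expnD subnKC.
pose F j := if (n.+2 <= j) && (j < N.+1) then cnt N (W j) else 0.
have hF : bsum N.+1 F * 2 ^ n.+2 <= 2 ^ N * 2 * 2.
  apply: geometric_sum => k hk; rewrite /F; first by rewrite leqNgt hk.
  by case: ifP => _; [exact: hW|rewrite mul0n].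
suff hS : cnt N (fun v => bexists N.+1 (fun t => dtest n t (v %% 2 ^ t))) <= bsum N.+1 F.
  apply: leq_trans (leq_mul hS (leqnn _)) _; move: hF; rewrite !expnS.
  set S := bsum _ _; set a := 2 ^ n; set b := 2 ^ N; nia.
apply: leq_trans (_ : cnt N (fun v => bexists N.+1 (fun j => (n.+2 <= j) && W j v)) <= _).
  apply: leq_cnt => v _ /bexistsP[t ht /bexistsP[j hj /andP[hnj h]]].
  apply/bexistsP; exists j; first exact: leq_trans hj ht.
  by rewrite hnj; apply/bexistsP; exists t.
apply: leq_trans (cnt_bexists _ _ _) _; apply: leq_bsum => j hj.
rewrite /F hj andbT; case: ifP => hnj; first exact: leqnn.
by rewrite cnt0.
Qed.

Definition dtest_strings (n : nat) : set bitseq := [set s | dtest n (size s) (strval s)]%classic.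

Lemma dtest_ml (R : realType) : ml_test R dtest_strings.
Proof.
split.
  (* The predicate ignores the search variable, so the search stops at 0 or never: its domain is the
     required c.e. set. *)
  pose P x (_ : nat) := dtest (nfst x) (slen (nsnd x)) (scval (nsnd x)).
  have [c hc] : exists c, forall x y, run no_oracle c x y <-> least (P x) y.
    by apply: pmin_run; rewrite /P; tl.
  exists c => n s.
  split=> [hs|[y]]; last first.
    by rewrite hc => /leastP[]; rewrite /P !npairE slen_code scval_code.
  by exists 0; rewrite hc; apply/leastP; rewrite /P !npairE slen_code scval_code.
move=> n; apply: ge_ereal_sup => _ [N _ <-].
rewrite lee_fin ler_pdivrMr ?exprn_gt0 // mulrC ler_pdivlMr ?exprn_gt0 //.
rewrite -!natrX -natrM ler_nat; apply: leq_trans (cnt_dtest n N).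
rewrite leq_mul2r; apply/orP; right; rewrite -card_strval; apply: subset_leq_card.
apply/fintype.subsetP => t; rewrite !inE => -[s hs hst]; apply/bexistsP.
have := size_prefix hst; rewrite size_tuple => hle.
by exists (size s) => //; rewrite -(prefix_strval hst).
Qed.

Lemma difference_test (R : realType) (z : real) : ml_random R z ->
  (forall k s, exists t0, forall t, t0 <= t -> cnt t (fun v => dset k s t v) * 2 ^ k <= 2 ^ t) ->
  (forall n, exists k s, n <= k /\ Uu k s (pre z s)) ->
  (forall k s t, Uu k s (pre z s) -> ~~ Vv k t (pre z t)) ->
  turing_le (chi halting) (chi z).
Proof.
move=> hz small often out.
have [n hn] : exists n, forall t, ~~ dtest n t (pre z t).
  apply: contrapT => hneg; apply: (hz _ (dtest_ml R)) => n.
  apply: contrapT => hn; apply: hneg; exists n => t; apply/negP => ht.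
  apply: hn; exists (mkseq z t); last by rewrite /prefix_of_real size_mkseq.
  by rewrite /dtest_strings /= size_mkseq strval_mkseq.
(* The test says nothing about the finitely many [j < n + 2]; one stage [s0] settles all of them. *)
have [s0 hs0] : exists s0, forall j, j < n.+2 -> halting j -> halted j s0.
  elim: n.+2 => [|m [s0 IH]]; first by exists 0.
  case: (boolP (halting m)) => [/haltingP[s hs]|hm].
    exists (s0 + s) => j; rewrite ltnS leq_eqVlt => /orP[/eqP-> _|hj hh].
      exact: halted_mono (leq_addl _ _) hs.
    exact: halted_mono (leq_addr _ _) (IH _ hj hh).
  exists s0 => j; rewrite ltnS leq_eqVlt => /orP[/eqP->|]; last exact: IH.
  by rewrite (negbTE hm).
(* The condition that the index is at most the stage places it in the range of [dunion] at every
   later stage. *)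
pose P j y := [&& j <= nfst y, nfst y <= nsnd y & Uu (nfst y) (nsnd y) (pre z (nsnd y))].
have [f [cf hf]] : exists f, turing_le f (chi z) /\ forall x, P x (f x).
  apply: tl_search; first by have := cU (chi z) => hU; rewrite /P; tl.
  move=> j; have [k [s [hk hs]]] := often j.
  exists (npair k (s + k)); rewrite /P !npairE hk leq_addl /=.
  by apply: mU (leq_addr k s) _; rewrite pre_mod ?leq_addr.
apply: (@turing_le_ext (fun j => halted j (nsnd (f j) + s0))); last by tl.
move=> j; rewrite /chi; congr nat_of_bool; apply/idP/idP => [h|hj].
  by apply/haltingP; exists (nsnd (f j) + s0).
case: (ltnP j n.+2) => hjn.
  exact: halted_mono (leq_addl _ _) (hs0 _ hjn hj).
have /haltingP[s1 /(@least_ex (halted j))[s _ hl]] := hj.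
case/and3P: (hf j); set k := nfst _; set r := nsnd _ => hjk hkr hU.
case: (leqP s (r + s0)) => [h|hrs]; first by apply: halted_mono h _; case/leastP: hl.
have {}hrs : r <= s by apply: leq_trans (ltnW hrs); exact: leq_addr.
have [t0 ht0] : exists t0, forall t, t0 <= t -> tame j s t.
  rewrite /tame; elim: s.+1 => [|m [t0 IH]]; first by exists 0.
  have [t1 h1] := small m s; exists (t0 + t1) => t ht.
  apply/bforallP => i; rewrite ltnS leq_eqVlt => /orP[/eqP->|hi].
    by rewrite h1 ?orbT // (leq_trans (leq_addl _ _) ht).
  by have /bforallP := IH t (leq_trans (leq_addr _ _) ht); apply.
(* If [j] entered after the stage found, [z] would be captured at any length [t] that is tame and
   bounds both [s] and [j]. *)
have := hn (t0 + s + j); set t := _ + _ + _; case/negP.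
have hst : s <= t by rewrite /t; lia.
apply/bexistsP; exists j; first by rewrite /t; lia.
rewrite hjn; apply/bexistsP; exists s; rewrite ?ltnS // hl ht0 /=; last by rewrite /t; lia.
apply/bexistsP; exists k; first by rewrite ltnS (leq_trans hkr).
rewrite hjk /dset pre_mod // (out _ _ _ hU) andbT /=.
by apply: (mU hrs); rewrite pre_mod.
Qed.

End DifferenceTest.

(** * Hitting sets *)

Lemma cntD t (P Q : nat -> bool) : (forall v, Q v -> P v) ->
  cnt t (fun v => P v && ~~ Q v) + cnt t Q = cnt t P.
Proof.
move=> h; rewrite /cnt /bsum -big_split; apply: eq_bigr => v _ /=.
by have := h v; case: (Q v) (P v) => [] [] // /(_ isT).
Qed.

(** At stage [s] the measure is below (b+1) 2^-n, and at stage [m] it was already at least b 2^-n,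
    so less than 2^-n was added in between. *)
Lemma cnt_threshold (P : nat -> nat -> bool) n b m s t :
  (forall s s' v, s <= s' -> P s (v %% 2 ^ s) -> P s' v) -> m <= s -> s <= t ->
  b = (cnt s (P s) * 2 ^ n) %/ 2 ^ s -> b * 2 ^ m <= cnt m (P m) * 2 ^ n ->
  cnt t (fun v => P s (v %% 2 ^ s) && ~~ P m (v %% 2 ^ m)) * 2 ^ n <= 2 ^ t.
Proof.
move=> mP hms hst hb hm.
have h1 : cnt t (fun v => P s (v %% 2 ^ s) && ~~ P m (v %% 2 ^ m))
    + cnt m (P m) * 2 ^ (t - m) = cnt s (P s) * 2 ^ (t - s).
  rewrite -!cnt_lift ?(leq_trans hms hst) //; apply: cntD => v hv.
  by apply: (mP m) => //; rewrite modn_exp2.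
have h2 : cnt s (P s) * 2 ^ n < b.+1 * 2 ^ s by rewrite hb -ltn_divLR ?expn_gt0.
move: h1; set A := cnt t _; set cm := cnt m _; set cs := cnt s _ => h1.
rewrite -/cm -/cs in hm h2.
have e1 : 2 ^ t = 2 ^ s * 2 ^ (t - s) by rewrite -expnD subnKC.
have e2 : 2 ^ t = 2 ^ m * 2 ^ (t - m) by rewrite -expnD subnKC ?(leq_trans hms).
have h3 : b * 2 ^ t <= cm * 2 ^ (t - m) * 2 ^ n.
  by rewrite e2 mulnA [leqRHS]mulnAC leq_mul.
have h4 : cs * 2 ^ (t - s) * 2 ^ n <= b.+1 * 2 ^ t.
  by rewrite e1 mulnA [leqLHS]mulnAC leq_mul // ltnW.
move: h4; rewrite -h1 mulnDl mulSn; lia.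
Qed.

(* Averaging: some point hits at least the mean proportion of the sets D v.    *)
Lemma hitting_step (N w s : nat) (P : nat -> bool) (D : nat -> nat -> bool) :
  0 < N -> (forall v, v < 2 ^ s -> P v -> w <= bsum N (fun i => D v i)) ->
  exists2 i, i < N & cnt s (fun v => P v && ~~ D v i) * N <= cnt s P * (N - w).
Proof.
move=> hN hD; apply: contrapT => hne.
have hlt i : i < N -> cnt s (fun v => P v && D v i) * N < cnt s P * w.
  move=> hi; rewrite ltnNge; apply/negP => hge; apply: hne; exists i => //.
  have e : cnt s (fun v => P v && ~~ D v i) + cnt s (fun v => P v && D v i) = cnt s P.
    by rewrite /cnt /bsum -big_split; apply: eq_bigr => v _; case: (P v) (D v i) => [] [].
  by rewrite mulnBr -e; move: hge; rewrite -e !mulnDl; lia.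
have hsum : cnt s P * w <= bsum N (fun i => cnt s (fun v => P v && D v i)).
  rewrite /cnt /bsum exchange_big /= big_distrl /=; apply: leq_sum => v _.
  case hP : (P v); last by rewrite mul0n.
  by rewrite mul1n; exact: hD (ltn_ord v) hP.
have : bsum N (fun i => cnt s (fun v => P v && D v i)) * N < cnt s P * w * N.
  case: N hN hlt {hD hne hsum} => // N _ hlt.
  rewrite /bsum big_distrl /= mulnC -[X in X * _](card_ord N.+1) -sum_nat_const.
  rewrite big_ord_recl [ltnRHS]big_ord_recl -addSn leq_add ?hlt //.
  by apply: leq_sum => i _; apply: ltnW; apply: hlt; exact: (ltn_ord (lift ord0 i)).
by rewrite ltn_mul2r => /andP[_]; rewrite ltnNge hsum.
Qed.

(** Greedy choice: each new point hits at least the fraction w/N of the sets not yet hit. *)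
Lemma hitting_iter (N w s r : nat) (P : nat -> bool) (D : nat -> nat -> bool) :
  0 < N -> (forall v, v < 2 ^ s -> P v -> w <= bsum N (fun i => D v i)) ->
  exists2 f : nat -> nat, (forall j, f j < N) &
    cnt s (fun v => P v && ~~ bexists r (fun j => D v (f j))) * N ^ r
      <= cnt s P * (N - w) ^ r.
Proof.
move=> hN hD; elim: r => [|r [f hf IH]].
  by exists (fun=> 0) => //; rewrite !expn0 !muln1; apply: leq_cnt => v _ /andP[].
have [i hi h] := @hitting_step N w s
  (fun v => P v && ~~ bexists r (fun j => D v (f j))) D hN
  (fun v hv hP => hD v hv (proj1 (andP hP))).
exists (fun j => if j < r then f j else i) => [j|]; first by case: ifP.
rewrite !expnS; set c' := cnt s _; set c := cnt s _ in h IH.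
have {}h : c' * N <= cnt s (fun v => P v && ~~ bexists r (fun j => D v (f j))) * (N - w).
  apply: leq_trans h; rewrite leq_mul2r; apply/orP; right.
  apply: leq_cnt => v _ /andP[-> /= hb]; apply/andP; split; last first.
    by apply: contra hb => hd; apply/bexistsP; exists r; rewrite ?ltnn.
  apply: contra hb => /bexistsP[j hj hd]; apply/bexistsP; exists j.
    exact: ltn_trans hj _.
  by rewrite hj.
rewrite mulnA; apply: leq_trans (leq_mul h (leqnn _)) _.
rewrite mulnAC; apply: leq_trans (leq_mul IH (leqnn _)) _.
by rewrite -mulnA [X in _ * X]mulnC.
Qed.

Lemma leq_expn m n e : m <= n -> m ^ e <= n ^ e.
Proof. by case: e => // e h; rewrite leq_exp2r. Qed.

Lemma bernoulli N w q : N ^ q * (N + q * w) <= N * (N + w) ^ q.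
Proof.
elim: q => [|q IH]; first by rewrite mul1n addn0 muln1.
rewrite !expnS; apply: (@leq_trans ((N + w) * (N ^ q * (N + q * w)))).
  rewrite [N * _]mulnC -mulnA [leqRHS]mulnCA leq_mul2l; apply/orP; right.
  by rewrite mulSn; nia.
by rewrite [leqRHS]mulnCA leq_mul.
Qed.

(** By Bernoulli (1 + w/N)^q >= 2, while (1 - w/N)(1 + w/N) <= 1; hence (1 - w/N)^q <= 1/2, and [r]
    contains [a] blocks of length [q]. *)
Lemma expn_gap N w q a r : 0 < N -> w <= N -> N <= q * w -> a * q <= r ->
  (N - w) ^ r * 2 ^ a <= N ^ r.
Proof.
move=> hN hw hq har.
have hNq : 0 < N ^ q by rewrite expn_gt0 hN.
have h1 : N ^ q * 2 <= (N + w) ^ q.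
  rewrite -(leq_pmul2l hN); apply: leq_trans (bernoulli _ _ _).
  rewrite mulnCA leq_mul2l; apply/orP; right; lia.
have h2 : (N - w) ^ q * 2 <= N ^ q.
  rewrite -(leq_pmul2r hNq) -mulnA [2 * _]mulnC.
  apply: leq_trans (leq_mul (leqnn _) h1) _.
  by rewrite -!expnMn; apply: leq_expn; rewrite -subn_sqr; exact: leq_subr.
rewrite -(subnKC har) !expnD mulnAC; apply: leq_mul; last first.
  by apply: leq_expn; exact: leq_subr.
by rewrite mulnC [a * q]mulnC !expnM -expnMn mulnC; apply: leq_expn.
Qed.

Lemma hitting_set (N w q a r s : nat) (P : nat -> bool) (D : nat -> nat -> bool) :
  0 < N -> w <= N -> N <= q * w -> a * q <= r ->
  (forall v, v < 2 ^ s -> P v -> w <= bsum N (fun i => D v i)) ->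
  exists2 f : nat -> nat, (forall j, f j < N) &
    cnt s (fun v => P v && ~~ bexists r (fun j => D v (f j))) * 2 ^ a <= 2 ^ s.
Proof.
move=> hN hw hq har hD; have [f hf h] := @hitting_iter N w s r P D hN hD.
exists f => //; have hNr : 0 < N ^ r by rewrite expn_gt0 hN.
rewrite -(leq_pmul2r hNr) mulnAC; apply: leq_trans (leq_mul h (leqnn _)) _.
rewrite -mulnA; apply: leq_mul; first exact: cnt_max.
exact: expn_gap hq har.
Qed.

(** Unlike the certificates, these sequences have no end marker: every number supplies an entry at
    every position. *)
Definition cnth (c j : nat) : nat := nfst (prec j c (fun _ r => nsnd r)).

Lemma tl_cnth o a b : turing_le a o -> turing_le b o ->
  turing_le (fun x => cnth (a x) (b x)) o.
Proof. by move=> ha hb; rewrite /cnth; tl. Qed.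
#[export] Hint Resolve tl_cnth : tl.

Lemma cnth_ex l (f : nat -> nat) : exists c, forall j, j < l -> cnth c j = f j.
Proof.
elim: l f => [|l IH] f; first by exists 0.
have [c hc] := IH (fun j => f j.+1); exists (npair (f 0) c) => -[|j] hj.
  by rewrite /cnth /= nfst_npair.
rewrite -hc // /cnth; congr nfst.
elim: j {hj} => [|j IHj]; first by rewrite /= nsnd_npair.
by rewrite [LHS]/= -[X in nsnd X]/(prec j.+1 _ (fun _ r => nsnd r)) IHj.
Qed.

(** * Batches and the compressed lists *)

Section Construction.
Variables (cg cT : prog) (w : nat -> nat).
Hypothesis cw : forall o, turing_le w o.
Hypothesis w_bound : forall m, 0 < w m /\ w m <= 2 ^ m.

(* Dominates the code length of every index <<n, b>, i> used at level n.       *)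
Definition threshold (n : nat) : nat :=
  let k := npair n (2 ^ n) in npair k (2 ^ k.+1) + k + n + 4.

(** These are the oracles X for which g^X is seen to reach [threshold n]. The argument [m] is below
    the stage [s], so for the monotone [g] of [z] the threshold is also reached at [s]. *)
Definition U1 (n s v : nat) : bool :=
  bexists s (fun m => bexists s (fun y => (threshold n <= y) && conv (prog_code cg) m y s v)).

(* For k = <n, b>, m is the stage at which the measure of U1 n reaches b 2^-n. *)
Definition batch (k m : nat) : bool :=
  least (fun s => nsnd k * 2 ^ s <= cnt s (fun v => U1 (nfst k) s v) * 2 ^ nfst k) m.

Definition V1 (n t v : nat) : bool :=
  bexists (2 ^ n).+1 (fun b => bexists t.+1 (fun m =>
    batch (npair n b) m && U1 n m (v %% 2 ^ m))).

(* The string of length m with value i has code 2 ^ m - 1 + i.                 *)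
Definition in_tree (m i s v : nat) : bool := conv (prog_code cT) (2 ^ m - 1 + i) 1 s v.

(** The bound on [nsnd k] keeps [k] below a computable function of [nfst k], as [threshold]
    requires. The last conjunct waits until as many strings of level [m] have appeared as the width
    predicts. *)
Definition U2 (k s v : nat) : bool :=
  (nsnd k <= 2 ^ nfst k) && bexists s.+1 (fun m =>
    [&& batch k m, U1 (nfst k) m (v %% 2 ^ m)
      & w m <= bsum (2 ^ m) (fun i => in_tree m i s v)]).

Definition elt (m c j : nat) : nat := cnth c j %% 2 ^ m.

(** The least [l] with 2^l w(m) >= 2 (k+1) 2^m, computed by counting the exponents that fail. It is
    the number of bits of an index into the list. *)
Definition list_bits (k m : nat) : nat :=
  bsum (m + k + 3) (fun l => 2 ^ l * w m < 2 * k.+1 * 2 ^ m).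

Definition hits (k m c s v : nat) : bool :=
  bexists (2 ^ list_bits k m) (fun j => in_tree m (elt m c j) s v).

(* e = <k, i> and u = <m, <s, c>>: batch k closes at stage m, U2 k reaches      *)
(* measure i 2^-(k+1) at stage s, and the list c meets the level m of T^X for  *)
(* all but 2^-(k+1) of the oracles X then in U2 k.                             *)
Definition good (e u : nat) : bool :=
  [&& batch (nfst e) (nfst u),
      least (fun s => nsnd e * 2 ^ s <= cnt s (fun v => U2 (nfst e) s v) * 2 ^ (nfst e).+1)
        (nfst (nsnd u))
    & cnt (nfst (nsnd u)) (fun v => U2 (nfst e) (nfst (nsnd u)) v
        && ~~ hits (nfst e) (nfst u) (nsnd (nsnd u)) (nfst (nsnd u)) v) * 2 ^ (nfst e).+1
      <= 2 ^ nfst (nsnd u)].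

Definition V2 (k t v : nat) : bool :=
  bexists (2 ^ k.+1).+1 (fun i => bexists t.+1 (fun u =>
    least (fun u' => good (npair k i) u') u && hits k (nfst u) (nsnd (nsnd u)) t v)).

(** * Computability of the construction *)

Lemma tl_threshold o a : turing_le a o -> turing_le (fun x => threshold (a x)) o.
Proof. by move=> ha; rewrite /threshold; tl. Qed.
#[local] Hint Resolve tl_threshold : tl.

Lemma tl_U1 o a b c : turing_le a o -> turing_le b o -> turing_le c o ->
  turing_le (fun x => nat_of_bool (U1 (a x) (b x) (c x))) o.
Proof. by move=> ha hb hc; rewrite /U1; tl. Qed.
#[local] Hint Resolve tl_U1 : tl.

Lemma tl_batch o a b : turing_le a o -> turing_le b o ->
  turing_le (fun x => nat_of_bool (batch (a x) (b x))) o.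
Proof. by move=> ha hb; rewrite /batch; tl. Qed.
#[local] Hint Resolve tl_batch : tl.

Lemma tl_V1 o a b c : turing_le a o -> turing_le b o -> turing_le c o ->
  turing_le (fun x => nat_of_bool (V1 (a x) (b x) (c x))) o.
Proof. by move=> ha hb hc; rewrite /V1; tl. Qed.
#[local] Hint Resolve tl_V1 : tl.

Lemma tl_w o a : turing_le a o -> turing_le (fun x => w (a x)) o.
Proof. exact: tl_comp. Qed.
#[local] Hint Resolve tl_w : tl.

Lemma tl_in_tree o a b c d :
  turing_le a o -> turing_le b o -> turing_le c o -> turing_le d o ->
  turing_le (fun x => nat_of_bool (in_tree (a x) (b x) (c x) (d x))) o.
Proof. by move=> ha hb hc hd; rewrite /in_tree; tl. Qed.
#[local] Hint Resolve tl_in_tree : tl.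

Lemma tl_U2 o a b c : turing_le a o -> turing_le b o -> turing_le c o ->
  turing_le (fun x => nat_of_bool (U2 (a x) (b x) (c x))) o.
Proof. by move=> ha hb hc; rewrite /U2; tl. Qed.
#[local] Hint Resolve tl_U2 : tl.

Lemma tl_elt o a b c : turing_le a o -> turing_le b o -> turing_le c o ->
  turing_le (fun x => elt (a x) (b x) (c x)) o.
Proof. by move=> ha hb hc; rewrite /elt; tl. Qed.
#[local] Hint Resolve tl_elt : tl.

Lemma tl_list_bits o a b : turing_le a o -> turing_le b o ->
  turing_le (fun x => list_bits (a x) (b x)) o.
Proof. by move=> ha hb; rewrite /list_bits; tl. Qed.
#[local] Hint Resolve tl_list_bits : tl.

Lemma tl_hits o a b c d e :
  turing_le a o -> turing_le b o -> turing_le c o -> turing_le d o -> turing_le e o ->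
  turing_le (fun x => nat_of_bool (hits (a x) (b x) (c x) (d x) (e x))) o.
Proof. by move=> ha hb hc hd he; rewrite /hits; tl. Qed.
#[local] Hint Resolve tl_hits : tl.

Lemma tl_good o a b : turing_le a o -> turing_le b o ->
  turing_le (fun x => nat_of_bool (good (a x) (b x))) o.
Proof. by move=> ha hb; rewrite /good; tl. Qed.
#[local] Hint Resolve tl_good : tl.

Lemma tl_V2 o a b c : turing_le a o -> turing_le b o -> turing_le c o ->
  turing_le (fun x => nat_of_bool (V2 (a x) (b x) (c x))) o.
Proof. by move=> ha hb hc; rewrite /V2; tl. Qed.
#[local] Hint Resolve tl_V2 : tl.

(** * Monotonicity in the stage *)

Lemma bexists_mono n n' (P Q : nat -> bool) : n <= n' ->
  (forall i, i < n -> P i -> Q i) -> bexists n P -> bexists n' Q.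
Proof.
move=> hn h /bexistsP[i hi hP]; apply/bexistsP; exists i; first exact: leq_trans hi hn.
exact: h.
Qed.

Lemma U1_mono n s s' v : s <= s' -> U1 n s (v %% 2 ^ s) -> U1 n s' v.
Proof.
move=> hs; apply: (bexists_mono hs) => m _; apply: (bexists_mono hs) => y _.
by move=> /andP[-> /(conv_mono hs) ->].
Qed.

Lemma V1_mono n s s' v : s <= s' -> V1 n s (v %% 2 ^ s) -> V1 n s' v.
Proof.
move=> hs; apply: (bexists_mono (leqnn _)) => b _.
apply: (@bexists_mono s.+1 s'.+1 _ _ hs) => m hm.
by rewrite modn_exp2.
Qed.

Lemma in_tree_mono m i s s' v : s <= s' -> in_tree m i s (v %% 2 ^ s) -> in_tree m i s' v.
Proof. exact: conv_mono. Qed.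

Lemma hits_mono k m c s s' v : s <= s' -> hits k m c s (v %% 2 ^ s) -> hits k m c s' v.
Proof. by move=> hs; apply: (bexists_mono (leqnn _)) => j _; apply: in_tree_mono. Qed.

Lemma U2_mono k s s' v : s <= s' -> U2 k s (v %% 2 ^ s) -> U2 k s' v.
Proof.
move=> hs; rewrite /U2 => /andP[-> h]; apply: (@bexists_mono s.+1 s'.+1 _ _ hs) h => m hm /and3P[-> h1 h2] /=.
move: h1; rewrite modn_exp2 // => -> /=.
apply: leq_trans h2 _; apply: leq_bsum => i _.
by have := @in_tree_mono m i s s' v hs; case: in_tree => // /(_ isT) ->.
Qed.

Lemma V2_mono k s s' v : s <= s' -> V2 k s (v %% 2 ^ s) -> V2 k s' v.
Proof.
move=> hs; apply: (bexists_mono (leqnn _)) => i _.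
apply: (@bexists_mono s.+1 s'.+1 _ _ hs) => u _.
by move=> /andP[-> /(hits_mono hs)].
Qed.

(** * Measure estimates for the two differences *)

Lemma leq_level P s n : (cnt s P * 2 ^ n) %/ 2 ^ s <= 2 ^ n.
Proof.
by rewrite -(leq_pmul2r (expn_gt0 2 s)) (leq_trans (leq_divM _ _)) // mulnC leq_mul ?cnt_max.
Qed.

Lemma U1V1_small n s t : s <= t ->
  cnt t (fun v => U1 n s (v %% 2 ^ s) && ~~ V1 n t v) * 2 ^ n <= 2 ^ t.
Proof.
move=> hst; set b := (cnt s (U1 n s) * 2 ^ n) %/ 2 ^ s.
have hb : b * 2 ^ s <= cnt s (U1 n s) * 2 ^ n by exact: leq_divM.
have [m hms hm] := @least_ex (fun s => b * 2 ^ s <= cnt s (U1 n s) * 2 ^ n) s hb.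
have := @cnt_threshold (U1 n) n b m s t (@U1_mono n) hms hst erefl (proj1 (leastP _ _ hm)).
apply: leq_trans; rewrite leq_mul2r; apply/orP; right; apply: leq_cnt => v _.
move=> /andP[-> hV] /=; apply: contra hV => hU.
apply/bexistsP; exists b; first by rewrite ltnS leq_level.
apply/bexistsP; exists m; first by rewrite ltnS (leq_trans hms).
by rewrite hU andbT /batch !npairE.
Qed.

(** The lower bound makes the list long enough for [hitting_set]; the upper bound keeps its indices
    short enough for compression. *)
Lemma list_bits_bounds k m :
  2 * k.+1 * 2 ^ m <= 2 ^ list_bits k m * w m <= 4 * k.+1 * 2 ^ m.
Proof.
pose P l := 2 * k.+1 * 2 ^ m <= 2 ^ l * w m.
have hP : P (m + k + 2).
  rewrite /P; apply: leq_trans (leq_pmulr _ (proj1 (w_bound m))).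
  rewrite -addnA addnC expnD leq_mul2r; apply/orP; right.
  by rewrite addn2 expnS expnS mulnA; have := ltn_expl k (ltnSn 1); lia.
have [l hl /leastP[hPl hmin]] := least_ex hP.
have -> : list_bits k m = l.
  rewrite /list_bits -[RHS](@bsum_ltn (m + k + 3) l); last by lia.
  apply: eq_bsum => i _; congr nat_of_bool; apply/idP/idP => hi.
    rewrite ltnNge; apply/negP => hli; move: hi; rewrite ltnNge => /negP; apply.
    by apply: leq_trans hPl _; rewrite leq_mul2r leq_exp2l // hli orbT.
  by have := hmin _ hi; rewrite /P -ltnNge.
apply/andP; split; first exact: hPl.
case: l hl hPl hmin => [|l] hl hPl hmin.
  by rewrite mul1n; apply: leq_trans (proj2 (w_bound m)) _; rewrite leq_pmull.
have := hmin l (ltnSn l); rewrite /P -ltnNge expnS -!mulnA => /ltnW h.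
by rewrite -[4]/(2 * 2) -!mulnA leq_mul2l.
Qed.

Lemma elt_ltn m c j : elt m c j < 2 ^ m.
Proof. by rewrite ltn_mod expn_gt0. Qed.

(** This is [hitting_set] on the [2 ^ m] strings of length [m], with [a = k.+1]. Uniqueness of the
    closing stage ensures that every oracle in [U2 k] shows at least [w m] strings at this same
    level. *)
Lemma good_ex k i m s : batch k m ->
  least (fun s => i * 2 ^ s <= cnt s (fun v => U2 k s v) * 2 ^ k.+1) s ->
  exists u, good (npair k i) u.
Proof.
move=> hm hs; have /andP[hL _] := list_bits_bounds k m.
have hq : 2 ^ m <= (2 ^ m %/ w m).+1 * w m by apply: ltnW; exact: ltn_ceil (proj1 (w_bound m)).
have hr : k.+1 * (2 ^ m %/ w m).+1 <= 2 ^ list_bits k m.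
  rewrite -(leq_pmul2r (proj1 (w_bound m))); apply: leq_trans hL; rewrite -mulnA [X in _ * X]mulSn.
  have := leq_divM (2 ^ m) (w m); have := proj2 (w_bound m).
  set a := _ %/ _ * _; set b := 2 ^ m; move=> h1 h2.
  by rewrite [2 * _]mulnC -mulnA leq_mul2l; apply/orP; right; lia.
have hN : 0 < 2 ^ m by rewrite expn_gt0.
have [|f hf h] := @hitting_set (2 ^ m) (w m) _ k.+1 (2 ^ list_bits k m) s
  (U2 k s) (fun v i => in_tree m i s v) hN (proj2 (w_bound m)) hq hr.
  move=> v _ /andP[_ /bexistsP[m' _ /and3P[hm' _ hw]]].
  by rewrite (least_uniq hm hm').
have [c hc] := cnth_ex (2 ^ list_bits k m) f.
exists (npair m (npair s c)); rewrite /good !npairE hm hs /=.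
apply: leq_trans h; rewrite leq_mul2r; apply/orP; right; apply: leq_cnt => v _.
move=> /andP[-> hn] /=; apply: contra hn; apply: (bexists_mono (leqnn _)) => j hj.
by rewrite /elt hc // modn_small.
Qed.

(** Two errors of at most 2^-(k+1) add up: the oracles that entered [U2 k] after the last multiple
    of 2^-(k+1) was passed, and those missed by the list chosen at that moment. *)
Lemma U2V2_small k s : exists t0, forall t, t0 <= t ->
  cnt t (fun v => U2 k s (v %% 2 ^ s) && ~~ V2 k t v) * 2 ^ k <= 2 ^ t.
Proof.
set i := (cnt s (U2 k s) * 2 ^ k.+1) %/ 2 ^ s.
have hi : i * 2 ^ s <= cnt s (U2 k s) * 2 ^ k.+1 by exact: leq_divM.
have [s0 hs0 hl] := @least_ex (fun s => i * 2 ^ s <= cnt s (U2 k s) * 2 ^ k.+1) s hi.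
(* If the batch never closes, [U2 k] is empty at every stage. *)
case: (pselect (exists m, batch k m)) => [[m hm]|hnm]; last first.
  exists 0 => t _; rewrite cnt0 ?mul0n // => v _; apply/negP => /andP[/andP[_ /bexistsP[m _]]].
  by move=> /and3P[hm _ _] _; apply: hnm; exists m.
have [u0 hu0] := good_ex hm hl; have [u _ hu] := least_ex hu0.
exists (s + u) => t ht.
have hst : s <= t by apply: leq_trans ht; exact: leq_addr.
have hut : u <= t by apply: leq_trans ht; exact: leq_addl.
have h1 := @cnt_threshold (U2 k) k.+1 i s0 s t (@U2_mono k) hs0 hst erefl (proj1 (leastP _ _ hl)).
have := proj1 (leastP _ _ hu); rewrite /good !npairE => /and3P[hm' hl' h2].
have es := least_uniq hl hl'; move: h2; rewrite -es => h2.
pose Q x := U2 k s0 x && ~~ hits k (nfst u) (nsnd (nsnd u)) s0 x.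
have h3 : cnt t (fun v => Q (v %% 2 ^ s0)) * 2 ^ k.+1 <= 2 ^ t.
  rewrite cnt_lift ?(leq_trans hs0) // mulnAC; apply: leq_trans (leq_mul h2 (leqnn _)) _.
  by rewrite -expnD subnKC // (leq_trans hs0).
rewrite -(leq_pmul2r (ltn0Sn 1)) -mulnA -expnSr.
apply: leq_trans (_ : (cnt t (fun v => U2 k s (v %% 2 ^ s) && ~~ U2 k s0 (v %% 2 ^ s0)) +
  cnt t (fun v => Q (v %% 2 ^ s0))) * 2 ^ k.+1 <= _); last by rewrite mulnDl muln2 -addnn leq_add.
rewrite leq_mul2r; apply/orP; right; apply: leq_trans (cntU _ _ _).
apply: leq_cnt => v _ /andP[-> hV] /=; rewrite /Q.
case: (boolP (U2 k s0 (v %% 2 ^ s0))) => //= _; apply: contra hV => hh.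
apply/bexistsP; exists i; first by rewrite ltnS leq_level.
apply/bexistsP; exists u; first by rewrite ltnS.
rewrite hu /=; apply: hits_mono hh; exact: leq_trans hst.
Qed.

End Construction.

(** * The machine and the theorem *)

Lemma strval_surj n v : v < 2 ^ n -> exists2 s, size s = n & strval s = v.
Proof.
elim: n v => [|n IH] v; first by case: v => // _; exists [::].
move=> hv; have [|s hs hsv] := IH v./2; first by move: hv; rewrite expnS; lia.
by exists (odd v :: s); rewrite /= ?hs // hsv; lia.
Qed.

Lemma bit_ones e j : j < e -> bit (2 ^ e - 1) j = 1.
Proof.
move=> hj; rewrite /bit; have -> : 2 ^ e - 1 = (2 ^ (e - j.+1) * 2 - 1) * 2 ^ j + (2 ^ j - 1).
  rewrite -{1}(subnK hj) expnD expnS; have := expn_gt0 2 (e - j.+1); have := expn_gt0 2 j.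
  set a := 2 ^ j; set b := 2 ^ _ => /= ha hb; nia.
rewrite divnMDl ?expn_gt0 // divn_small ?addn0; last by have := expn_gt0 2 j; lia.
have := expn_gt0 2 (e - j.+1); set b := 2 ^ _ => /= hb; lia.
Qed.

Section Machine.
Variables (cg cT : prog) (w : nat -> nat).
Hypothesis cw : forall o, turing_le w o.

(* y = <e, u> where x codes the string 1 ^ e 0 rho, with rho of the length     *)
(* prescribed by the least u such that good e u.                               *)
Definition decode (x y : nat) : bool :=
  [&& nfst y < slen x, bforall (nfst y) (fun j => bit (scval x) j == 1),
      bit (scval x) (nfst y) == 0, least (fun u => good cg cT w (nfst y) u) (nsnd y)
    & slen x == (nfst y).+1 + list_bits w (nfst (nfst y)) (nfst (nsnd y))].

Definition output (x y : nat) : nat :=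
  2 ^ nfst (nsnd y) - 1
  + elt (nfst (nsnd y)) (nsnd (nsnd (nsnd y))) (scval x %/ 2 ^ (nfst y).+1).

(** The code is self-delimiting: the first zero determines [e], then [e] determines [u], and both
    determine the total length. *)
Lemma decode_prefix p q y y' : prefix p q ->
  decode (str_code p) y -> decode (str_code q) y' -> y = y' /\ p = q.
Proof.
move=> hpq; rewrite /decode !slen_code !scval_code.
move=> /and5P[h1 /bforallP h2 /eqP h3 h4 /eqP h5] /and5P[h1' /bforallP h2' /eqP h3' h4' /eqP h5'].
have hbit j : j < size p -> bit (strval q) j = bit (strval p) j.
  by move=> hj; rewrite (prefix_strval hpq) bit_mod.
have hy1 : nfst y = nfst y'.
  case: (ltngtP (nfst y) (nfst y')) => // [/h2'|hlt].
    by rewrite hbit // h3.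
  by move: (h2 _ hlt); rewrite -hbit ?h3' // (ltn_trans hlt).
rewrite -hy1 in h4' h5'; have hy2 := least_uniq h4 h4'.
rewrite -hy2 -h5 in h5'; split; first by rewrite -(npair_eta y) -(npair_eta y') hy1 hy2.
by move/prefixP: hpq h5' => [r ->]; rewrite size_cat; case: r => [|b r] /=; rewrite ?cats0 //; lia.
Qed.

Lemma decode_ex e u j : least (fun u => good cg cT w e u) u ->
  j < 2 ^ list_bits w (nfst e) (nfst u) ->
  exists p, [/\ size p = e.+1 + list_bits w (nfst e) (nfst u),
    decode (str_code p) (npair e u)
  & output (str_code p) (npair e u) = 2 ^ nfst u - 1 + elt (nfst u) (nsnd (nsnd u)) j].
Proof.
set L := list_bits _ _ _ => hu hj.
(* With the least significant bit first, this is the value of 1^e 0 followed by the binary digits of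
   [j]. *)
pose v := j * 2 ^ e.+1 + (2 ^ e - 1).
have he : 2 ^ e - 1 < 2 ^ e by rewrite subn1 prednK ?expn_gt0.
have he' : 2 ^ e - 1 < 2 ^ e.+1 by apply: ltn_trans he _; rewrite ltn_exp2l.
have hv : v < 2 ^ (e.+1 + L).
  rewrite /v addnC expnD mulnC; apply: (@leq_trans (2 ^ e.+1 + j * 2 ^ e.+1)).
    by rewrite mulnC ltn_add2r.
  by rewrite -mulSn mulnC leq_mul2l hj orbT.
have [p hp hpv] := strval_surj hv; exists p; split=> //.
  rewrite /decode slen_code scval_code !npairE hp hpv hu eqxx !andbT.
  apply/and3P; split; first by rewrite ltnS leq_addr.
    apply/bforallP => i hi; rewrite -(@bit_mod _ e) // /v expnS mulnCA mulnA -mulnA.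
    by rewrite mulnA modnMDl modn_small // bit_ones.
  rewrite /bit /v expnS mulnA divnMDl ?expn_gt0 // divn_small // addn0.
  by rewrite modnMl.
rewrite /output !npairE scval_code hpv /v divnMDl ?expn_gt0 //.
by rewrite divn_small // addn0.
Qed.

Lemma decoder : exists M, prefix_free_machine M /\
  forall x y, decode x y -> run no_oracle M x (output x y).
Proof.
have [c hc] : exists c, forall x y, run no_oracle c x y <-> least (decode x) y.
  apply: pmin_run; rewrite /decode.
  have h := @tl_good cg cT w cw no_oracle; have h' := @tl_list_bits w cw no_oracle.
  typeclasses eauto 1000 with tl.
have [d hd] : turing_le (fun p => output (nfst p) (nsnd p)) no_oracle.
  have h := @tl_elt no_oracle.
  rewrite /output; typeclasses eauto 1000 with tl.
have [i hi] := tl_id no_oracle.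
pose M := PComp d (PPair i c).
have MP x r : run no_oracle M x r <-> exists2 y, least (decode x) y & r = output x y.
  split=> [[q [x' [y [hx hy ->]]] hr]|[y hy ->]].
    exists y; first by rewrite -hc.
    by rewrite (run_det hx (hi x)) in hr; rewrite (run_det hr (hd _)) !npairE.
  exists (npair x y); first by exists x, y; split; [exact: hi|rewrite hc|].
  by have := hd (npair x y); rewrite !npairE.
exists M; split=> [p q s t|x y hxy].
  move=> /MP[y /leastP[hy _] _] /MP[y' /leastP[hy' _] _] hpq.
  by have [] := decode_prefix hpq hy hy'.
(* Decoding is unique, by [decode_prefix] applied to a string and itself, so the least witness is
   [y]. *)
apply/MP; exists y => //; have [y' _ hl] := least_ex hxy.
have [s hs] := str_code_surj x; have [hy' _] := leastP _ _ hl.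
rewrite -hs in hxy hy'; have [-> _] := decode_prefix (prefix_refl s) hxy hy'.
exact: hl.
Qed.

End Machine.

(** Logarithms are taken, using 4 (k+1) <= 2^(k+2). *)
Lemma log2_width (R : realType) (k m L W : nat) : 0 < W -> 2 ^ L * W <= 4 * k.+1 * 2 ^ m ->
  (L%:R + log2 W%:R <= (k + m + 2)%:R :> R)%R.
Proof.
move=> hW h; have ln2 : (0 < ln 2 :> R)%R by rewrite ln_gt0 // ltr1n.
have hX n : (ln (2 ^+ n) = n%:R * ln 2 :> R)%R by rewrite lnXn // mulr_natl.
rewrite /log2 -(ler_pM2r ln2) mulrDl divfK ?gt_eqF // -!hX -lnM ?posrE ?exprn_gt0 ?ltr0n //.
rewrite ler_ln ?posrE ?mulr_gt0 ?exprn_gt0 ?ltr0n //.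
rewrite -!natrX -natrM ler_nat; apply: leq_trans h _.
rewrite mulnC addnAC addnC expnD leq_mul2l; apply/orP; right.
by rewrite addnC expnD leq_mul2l /=; apply: ltn_expl.
Qed.

(** * The oracle z in the two difference tests *)

Section Main.
Variables (R : realType) (U : prog) (hU : optimal_machine R U).
Variables (z : real) (T : {pred bitseq}) (g : nat -> nat).
Variables (cg cT : prog).
Hypothesis hcg : forall n, run (chi z) cg n (g n).
Hypothesis hcT : forall s, run (chi z) cT (str_code s) (nat_of_bool (s \in T)).
Hypothesis hg : order_function g.
Hypothesis hw : forall o, turing_le (width T) o.
Hypothesis hT : is_tree T.
Hypothesis hpruned : pruned T.
Hypothesis hTg : forall n : nat,
      ((g n)%:R%:E + deficiency R U (level T n) <= (log2 (width T n)%:R)%:E)%E.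

Local Notation w := (width T).
Local Notation U1 := (U1 cg).
Local Notation V1 := (V1 cg).
Local Notation batch := (batch cg).
Local Notation U2 := (U2 cg cT w).
Local Notation V2 := (V2 cg cT w).

(** A pruned tree has strings of every length above a given one, and their prefixes populate level
    [m]. *)
Lemma width_bound m : 0 < w m /\ w m <= 2 ^ m.
Proof.
split; last by apply: leq_trans (max_card _) _; rewrite card_tuple card_bool.
have [[s0 hs0] hdown] := hT.
have [s hs hm] : exists2 s, s \in T & m <= size s.
  elim: m => [|m [s hs hm]]; first by exists s0.
  apply: contrapT => hne; apply: hpruned; exists s => // t ht hst.
  have hle := size_prefix hst.
  have hts : size t <= size s.
    by apply: leq_trans hm; rewrite leqNgt; apply/negP => h; apply: hne; exists t.
  by move/prefixP: hst hts => [[|b r] ->]; rewrite ?cats0 // size_cat /=; lia.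
have hsz : size (take m s) == m by rewrite size_takel.
apply/card_gt0P; exists (Tuple hsz); rewrite inE /=.
by apply: hdown hs _; exact: prefix_take.
Qed.

Lemma U1_sound n m : U1 n m (pre z m) -> threshold n <= g m.
Proof.
move=> /bexistsP[m' hm' /bexistsP[y _ /andP[hy /conv_pre_sound hc]]].
by rewrite (run_det hc (hcg m')) in hy; apply: leq_trans hy _; apply: hg.1; exact: ltnW.
Qed.

Lemma U1_ex n : exists s, U1 n s (pre z s).
Proof.
have [m hm] := hg.2 (threshold n); have [s0 hs0] := conv_pre_complete (hcg m).
exists (s0 + m + g m).+1; apply/bexistsP; exists m; first by lia.
apply/bexistsP; exists (g m); first by lia.
by rewrite ltnW //= hs0 //; lia.
Qed.

Lemma in_tree_sound m i s : i < 2 ^ m -> in_tree cT m i s (pre z s) ->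
  exists2 t, t \in T & size t = m /\ str_code t = 2 ^ m - 1 + i.
Proof.
move=> hi hc; have [t ht htv] := strval_surj hi.
have e : str_code t = 2 ^ m - 1 + i.
  by have := str_codeE t; rewrite ht htv; have := expn_gt0 2 m => /=; lia.
exists t => //; move/conv_pre_sound: hc; rewrite -e => hc.
by have := run_det hc (hcT t); case: (t \in T).
Qed.

Lemma in_tree_complete m : exists s0, forall s, s0 <= s ->
  w m <= bsum (2 ^ m) (fun i => in_tree cT m i s (pre z s)).
Proof.
have [s0 hs0] : exists s0, forall s t, s0 <= s -> t \in T -> size t = m ->
    in_tree cT m (strval t) s (pre z s).
  (* Level [m] is finite: induction on a bound for [strval] takes a common stage for all its
     strings. *)
  have [s0 hs0] : exists s0, forall s t, s0 <= s -> t \in T -> size t = m ->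
      strval t < 2 ^ m -> in_tree cT m (strval t) s (pre z s).
    elim: (2 ^ m) => [|l [s0 IH]]; first by exists 0.
    case: (pselect (exists t, [/\ t \in T, size t = m & strval t = l])); last first.
      move=> hne; exists s0 => s t hs ht hm; rewrite ltnS leq_eqVlt => /orP[/eqP hl|]; last exact: IH.
      by case: hne; exists t.
    move=> [t [ht hm hl]]; have := hcT t; rewrite ht => /conv_pre_complete[s1 hs1].
    exists (s0 + s1) => s t' hs ht' hm'; rewrite ltnS leq_eqVlt => /orP[/eqP hl'|hl']; last first.
      by apply: IH => //; apply: leq_trans hs; exact: leq_addr.
    have -> : t' = t by apply: strval_inj; rewrite ?hm ?hl.
    have e : str_code t = 2 ^ m - 1 + strval t.
      by have := str_codeE t; rewrite hm; have := expn_gt0 2 m => /=; lia.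
    by rewrite /in_tree -e hs1 // (leq_trans (leq_addl s0 s1)).
  by exists s0 => s t hs ht hm; apply: hs0 => //; rewrite -hm ltn_strval.
exists s0 => s hs; rewrite -[leqRHS](card_strval m (fun i => in_tree cT m i s (pre z s))).
apply: subset_leq_card; apply/fintype.subsetP => t; rewrite !inE => ht.
by apply: hs0 => //; rewrite size_tuple.
Qed.

(** With oracle [z] the reduction really computes [T], so level [m] eventually shows its full
    width. *)
Lemma U2_ex n t : V1 n t (pre z t) -> exists k s, n <= k /\ nfst k = n /\ U2 k s (pre z s).
Proof.
move=> /bexistsP[b hb /bexistsP[m hm /andP[hbat hU1]]].
have [s0 hs0] := in_tree_complete m.
exists (npair n b), (s0 + m); split; first exact: leq_npairl.
split; first exact: nfst_npair.
apply/andP; rewrite nfst_npair nsnd_npair -ltnS; split; first exact: hb.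
apply/bexistsP; exists m; first by rewrite ltnS leq_addl.
rewrite pre_mod ?leq_addl //; move: hU1; rewrite pre_mod // => hU1.
apply/and3P; split; [exact: hbat|exact: hU1|exact: hs0 (leq_addr _ _)].
Qed.

Lemma leq_threshold k i : nsnd k <= 2 ^ nfst k -> i <= 2 ^ k.+1 ->
  npair k i + k + nfst k + 4 <= threshold (nfst k).
Proof.
move=> hk hi; have h : k <= npair (nfst k) (2 ^ nfst k) by rewrite -{1}(npair_eta k) leq_npair.
have hn : npair k i <= npair (npair (nfst k) (2 ^ nfst k)) (2 ^ (npair (nfst k) (2 ^ nfst k)).+1).
  by apply: (leq_npair h); apply: (leq_trans hi); rewrite leq_exp2l.
by rewrite /threshold leq_add2r leq_add2r; apply: leq_add.
Qed.

(** If [z] were hit, some string of [T] of length [m] would have complexity at most e + 1 + L + K,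
    where e = [npair k i], L = [list_bits w k m], and [K] is the coding constant of the decoder. The
    assumed bound on [g] and L + log w(m) <= m + k + 2 then give g(m) <= e + k + K + 3. But
    [threshold] forces g(m) >= e + k + K + 4 once [nfst k >= K]. *)
Lemma V2_out : exists K, forall k s t, K <= nfst k ->
  U2 k s (pre z s) -> ~~ V2 k t (pre z t).
Proof.
have [M [hpf hM]] := decoder cg cT hw; have [K hK] := hU.2 M hpf.
exists K => k s t hKk /andP[hb /bexistsP[m hm /and3P[hbat hU1 _]]].
rewrite pre_mod // in hU1; have hth := U1_sound hU1.
apply/negP => /bexistsP[i hi /bexistsP[u hu /andP[hl /bexistsP[j hj hin]]]].
have /and3P[hbat' _ _] := proj1 (leastP _ _ hl).
rewrite nfst_npair in hbat'; have em := least_uniq hbat' hbat.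
have [sig hsT [hsz hsc]] := in_tree_sound (elt_ltn _ _ _) hin.
have hj' : j < 2 ^ list_bits w (nfst (npair k i)) (nfst u) by rewrite nfst_npair.
have [p [hp hd ho]] := decode_ex hl hj'.
rewrite nfst_npair em in hp; rewrite em in hsz.
have /andP[_ hL] := list_bits_bounds width_bound k m.
set L := list_bits w k m in hp hL.
have hlog := @log2_width R k m L (w m) (proj1 (width_bound m)) hL.
have hrun : machine M p sig.
  by rewrite /machine hsc -ho; exact: hM.
have hcM : (complexity R M sig <= (size p)%:R%:E)%E.
  by apply: ereal_inf_lbound; exists p.
have hcU : (complexity R U sig <= ((size p + K)%:R)%:E)%E.
  apply: le_trans (hK sig) _; rewrite natrD EFinD; exact: leeD2r.
have hdef : ((m%:R - (size p + K)%:R)%:E <= deficiency R U (level T m))%E.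
  apply: le_trans (_ : ((size sig)%:R%:E - complexity R U sig <= _)%E).
    by rewrite EFinB hsz; apply: leeB.
  by apply: ereal_sup_ubound; exists sig.
have : ((g m)%:R + (m%:R - (size p + K)%:R) <= log2 (w m)%:R :> R)%R.
  rewrite -lee_fin; apply: le_trans (hTg m); rewrite EFinD; exact: leeD2l.
have : ((npair k i + k + K + 4)%:R <= (g m)%:R :> R)%R.
  rewrite ler_nat; apply: leq_trans hth; apply: leq_trans (leq_threshold hb _); last exact: hi.
  by rewrite leq_add2r leq_add2l.
rewrite hp -[(npair k i).+1]addn1; move: hlog; rewrite !natrD; lra.
Qed.

End Main.

Theorem theorem1p7 (R : realType) (U : prog) (hU : optimal_machine R U)
    (z : real) (T : {pred bitseq}) (g : nat -> nat)
    (hz : ml_random R z)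
    (hT : is_tree T) (hpruned : pruned T) (hproper : proper_tree T)
    (hzT : computes_strings z T)
    (hg : order_function g) (hzg : turing_le g (chi z))
    (hTg : forall n : nat,
      ((g n)%:R%:E + deficiency R U (level T n)
         <= (log2 (width T n)%:R)%:E)%E)
    (hwidth : computable (width T)) :
  turing_le (chi halting) (chi z).
Proof.
have [cg hcg] := hzg; have [cT hcT] := hzT.
have hw o := computable_turing_le o hwidth.
have hwb := width_bound hT hpruned.
(* Either [z] is in no closed batch for all large [n], and [U1], [V1] serve as the difference test,
   or it is in batches for infinitely many [n], and [U2], [V2] do. *)
case: (pselect (exists n0, forall n t, n0 <= n -> ~~ V1 cg n t (pre z t))) => [[n0 hn0]|hneg].
  apply: (@difference_test (fun n s v => (n0 <= n) && U1 cg n s v) (V1 cg) _ _ _ _ R z hz).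
  - by move=> o; have h := @tl_U1 cg o; typeclasses eauto 1000 with tl.
  - by move=> o; apply: tl_V1; tl.
  - by move=> k s s' v hs /andP[-> h]; apply: (U1_mono hs h).
  - exact: V1_mono.
  - move=> n s; exists s => t hst; apply: leq_trans (U1V1_small cg n hst).
    rewrite leq_mul2r; apply/orP; right; apply: leq_cnt => v _.
    by rewrite /dset => /andP[/andP[_ ->]].
  - move=> n; have [s hs] := U1_ex hcg hg (n0 + n).
    by exists (n0 + n), s; rewrite leq_addl leq_addr.
  - by move=> n s t /andP[hn _]; exact: hn0.
have [K hK] := V2_out hU hcg hcT hg hw hT hpruned hTg.
(* Restricting to [K <= nfst k] keeps only the indices for which [V2_out] applies; infinitely many
   of them still contain [z]. *)
apply: (@difference_test (fun k s v => (K <= nfst k) && U2 cg cT (width T) k s v)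
  (V2 cg cT (width T)) _ _ _ _ R z hz).
- by move=> o; have h := @tl_U2 cg cT _ hw o; typeclasses eauto 1000 with tl.
- by move=> o; apply: tl_V2 => //; tl.
- by move=> k s s' v hs /andP[-> h]; apply: (U2_mono hs h).
- exact: V2_mono.
- move=> k s; have [t0 ht0] := U2V2_small cg cT hwb k s; exists t0 => t /ht0.
  apply: leq_trans; rewrite leq_mul2r; apply/orP; right; apply: leq_cnt => v _.
  by rewrite /dset => /andP[/andP[_ ->]].
- move=> n; have [m [t [hm ht]]] : exists m t, n + K <= m /\ V1 cg m t (pre z t).
    apply: contrapT => h; apply: hneg; exists (n + K) => m t hm; apply/negP => ht.
    by apply: h; exists m, t.
  have [k [s [hmk [hk hs]]]] := U2_ex hcT ht.
  exists k, s; rewrite hk hs (leq_trans _ hmk) ?(leq_trans _ hm) ?leq_addr ?leq_addl //.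
- by move=> k s t /andP[hk hs]; exact: hK hk hs.
Qed.
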